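(* Let $\theta\in\mathbb R$ and let $\Theta=(\theta_{k,\ell})$ be a real antisymmetric $d\times d$ matrix such that $\theta_{k,\ell}=\theta$ for all $k<\ell$. Then $$c_\Theta=\frac{2d}{\|u_{\Theta,1}+u_{\Theta,1}^*+\dots+u_{\Theta,d}+u_{\Theta,d}^*\|}.$$
   Context: For a real antisymmetric $d\times d$ matrix $\Theta=(\theta_{k,\ell})$, $A_\Theta$ is the universal C*-algebra generated by unitaries $u_{\Theta,1},\dots,u_{\Theta,d}$ satisfying $u_{\Theta,\ell}u_{\Theta,k}=e^{i\theta_{k,\ell}}u_{\Theta,k}u_{\Theta,\ell}$ for all $k,\ell$, and $u_\Theta=(u_{\Theta,1},\dots,u_{\Theta,d})$. For $\Theta=0$, $u_0$ is the universal $d$-tuple of commuting unitaries (generators of $C(\mathbb T^d)$). For $d$-tuples of unitaries write $u\sim v$ if there is a $*$-isomorphism $C^*(u)\to C^*(v)$ mapping $u_i\mapsto v_i$ for all $i$. For $c>0$ write $u\prec cv$ if there exist Hilbert spaces $H\subseteq K$ and tuples $U\in B(H)^d$, $V\in B(K)^d$ with $U\sim u$, $V\sim v$ and $U_i=P_H\,cV_i|_H$ for all $i$, where $P_H$ is the orthogonal projection of $K$ onto $H$. Put $c(u,v)=\inf\{c: u\prec cv\}$ and $c_\Theta:=c(u_\Theta,u_0)$. *)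

(* Defs.v *)
From HB Require Import structures.
From mathcomp Require Import all_boot all_order all_algebra.
From mathcomp Require Import sesquilinear complex.
From mathcomp Require Import all_classical all_reals all_analysis.
From mathcomp Require Import ring lra.

Set Implicit Arguments.
Unset Strict Implicit.
Unset Printing Implicit Defensive.

Import Order.TTheory GRing.Theory Num.Theory.
Import numFieldNormedType.Exports.

Local Open Scope classical_set_scope.
Local Open Scope ring_scope.
Local Open Scope complex_scope.

HB.mixin Record isHilbert (R : realType) H & CompleteNormedModule R[i] H := {
  inner : {dot H for Num.conj};
  normr_inner : forall x : H, `|x| ^+ 2 = inner x x
}.

#[short(type="hilbertType")]
HB.structure Definition Hilbert (R : realType) :=
  {H of CompleteNormedModule R[i] H & isHilbert R H}.

HB.mixin Record isCstarAlgebra (R : realType) A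
    & CompleteNormedModule R[i] A := {
  cmul : A -> A -> A;
  cone : A;
  cmulA : associative cmul;
  cmul1l : left_id cone cmul;
  cmul1r : right_id cone cmul;
  cmulDl : left_distributive cmul +%R;
  cmulDr : right_distributive cmul +%R;
  cscalerAl : forall (a : R[i]) (x y : A), a *: cmul x y = cmul (a *: x) y;
  cscalerAr : forall (a : R[i]) (x y : A), a *: cmul x y = cmul x (a *: y);
  cnormM : forall x y : A, `|cmul x y| <= `|x| * `|y|;
  star : A -> A;
  starD : {morph star : x y / x + y};
  starZ : forall (a : R[i]) (x : A), star (a *: x) = Num.conj a *: star x;
  starM : forall x y : A, star (cmul x y) = cmul (star y) (star x);
  starK : involutive star;
  norm_starM : forall x : A, `|cmul (star x) x| = `|x| ^+ 2
}.

#[short(type="cstarAlgType")]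
HB.structure Definition CstarAlgebra (R : realType) :=
  {A of CompleteNormedModule R[i] A & isCstarAlgebra R A}.

(* The zero algebra (e.g. the operators on the zero space) is allowed, so that
   these are rings in which 1 = 0 is not excluded, and not an [algType]. *)
#[non_forgetful_inheritance]
HB.instance Definition _ (R : realType) (A : cstarAlgType R) :=
  GRing.Zmodule_isPzRing.Build (CstarAlgebra.sort A)
    cmulA cmul1l cmul1r cmulDl cmulDr.

(* Norms on modules over R[i] take their values in R[i]. *)
Definition normR (R : realType) (V : normedModType R[i]) (x : V) : R :=
  complex.Re `|x|.

Lemma normRE (R : realType) (V : normedModType R[i]) (x : V) :
  `|x| = (normR x)%:C.
Proof. by rewrite /normR RRe_real// normr_real. Qed.

Lemma normR_ge0 (R : realType) (V : normedModType R[i]) (x : V) : 0 <= normR x.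
Proof. by rewrite -lecR -normRE normr_ge0. Qed.

Section HilbertTheory.
Context {R : realType} {H : hilbertType R}.
Implicit Types (x y z : H) (a : R[i]).

Lemma innerC x y : inner x y = Num.conj (inner y x).
Proof. by rewrite hermC expr0 mul1r. Qed.

Lemma innerDl x y z : inner (x + y) z = inner x z + inner y z.
Proof. by rewrite linearDl. Qed.

Lemma innerDr x y z : inner x (y + z) = inner x y + inner x z.
Proof. by rewrite linearDr. Qed.

Lemma innerZl a x y : inner (a *: x) y = a * inner x y.
Proof. by rewrite linearZl_LR. Qed.

Lemma innerZr a x y : inner x (a *: y) = Num.conj a * inner x y.
Proof. by rewrite linearZr_LR. Qed.

Lemma innerNl x y : inner (- x) y = - inner x y.
Proof. by rewrite linearNl. Qed.
Lemma innerNr x y : inner x (- y) = - inner x y.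
Proof. by rewrite linearNr. Qed.

Lemma parallelogram x y :
  `|x + y| ^+ 2 + `|x - y| ^+ 2 = 2 * (`|x| ^+ 2 + `|y| ^+ 2).
Proof.
rewrite !normr_inner !(innerDl, innerDr, innerNl, innerNr).
ring.
Qed.

Lemma norm_sub_proj x y : y != 0 ->
  `|x - (inner x y / `|y| ^+ 2) *: y| ^+ 2
  = `|x| ^+ 2 - `|inner x y| ^+ 2 / `|y| ^+ 2.
Proof.
move=> y0; have yy : inner y y != 0 by rewrite -normr_inner expf_neq0 ?normr_eq0.
have cyy : Num.conj (inner y y) = inner y y by rewrite -innerC.
rewrite [`|inner x y| ^+ 2]normCK.
rewrite !normr_inner !(innerDl, innerDr, innerNl, innerNr, innerZl, innerZr).
rewrite (innerC y x) rmorphM/= fmorphV/= cyy.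
field.
exact: yy.
Qed.

Lemma inner_CauchySchwarz x y : `|inner x y| <= `|x| * `|y|.
Proof.
have [->|y0] := eqVneq y 0; first by rewrite linear0r !normr0 mulr0.
rewrite -(@ler_pXn2r _ 2) ?nnegrE ?mulr_ge0//.
rewrite exprMn -ler_pdivrMr ?exprn_gt0 ?normr_gt0// -subr_ge0 -norm_sub_proj//.
Qed.

Lemma gt0_Re (e : R[i]) : 0 < e -> 0 < complex.Re e /\ e = (complex.Re e)%:C.
Proof.
move=> e0; have eE : e = (complex.Re e)%:C by rewrite RRe_real// gtr0_real.
by split=> //; rewrite -ltcR -eE.
Qed.

Lemma normR_triangle x y z : normR (x - z) <= normR (x - y) + normR (y - z).
Proof.
by rewrite -lecR rmorphD/= -!normRE; apply: ler_distD.
Qed.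

Lemma normRZ (V : normedModType R[i]) a (x : V) :
  normR (a *: x) = complex.Re `|a| * normR x.
Proof.
by apply: complexI; rewrite rmorphM/= -normRE normrZ normRE RRe_real ?normr_real.
Qed.

Lemma normR_sub (x y : H) : normR (x - y) = normR (y - x).
Proof. by rewrite /normR distrC. Qed.

Lemma parallelogramR x y :
  normR (x + y) ^+ 2 + normR (x - y) ^+ 2 = 2 * (normR x ^+ 2 + normR y ^+ 2).
Proof.
apply: complexI; have := parallelogram x y.
by rewrite !normRE rmorphM rmorph_nat !rmorphD !rmorphXn.
Qed.

Lemma orth_proj_ex (K : set H) x : closed K -> K 0 ->
  (forall a y z, K y -> K z -> K (a *: y + z)) ->
  exists2 y, K y & forall z, K z -> inner (x - y) z = 0.
Proof.
move=> clK K0 Klin.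
pose D := [set normR (x - k) | k in K]; pose d := inf D.
have Dlb : lbound D 0 by move=> _ [k _ <-]; exact: normR_ge0.
have hiD : has_inf D by split; [exists (normR (x - 0)), 0|exists 0].
have d0 : 0 <= d by apply: lb_le_inf => //; exact: hiD.1.
have d_le k : K k -> d <= normR (x - k).
  by move=> Kk; apply: ge_inf; [exists 0|exists k].
pose B (e : R) := [set k | K k /\ normR (x - k) < d + e].
have B_ex (e : R) : 0 < e -> exists k, B e k.
  by move=> /(inf_adherent)/(_ hiD)[_ [k Kk <-] lt]; exists k.
have dist k k' (e : R) : 0 < e -> B e k -> B e k' ->
    normR (k - k') ^+ 2 <= 4 * (e * (2 * d + e)).
  move=> e0 [Kk ke] [Kk' ke'].
  have := parallelogramR (x - k) (x - k').
  have -> : x - k - (x - k') = k' - k by rewrite opprB addrC addrA subrK.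
  have -> : x - k + (x - k') = 2 *: (x - (2^-1 *: k + 2^-1 *: k')).
    by rewrite scalerBr scalerDr !scalerA divff ?pnatr_eq0// !scale1r scaler_nat
      mulr2n opprD addrACA.
  have Km : K (2^-1 *: k + 2^-1 *: k').
    by apply: (Klin) => //; rewrite -[_ *: _]addr0; exact: (Klin).
  move: (d_le _ Km) (d_le _ Kk) (d_le _ Kk').
  rewrite normRZ normr_nat /= (normR_sub k' k).
  move: (normR _) (normR _) (normR _) (normR _) ke ke' => m n p q pe qe dm dp dq.
  have m2 : d ^+ 2 <= n ^+ 2 by rewrite lerXn2r ?nnegrE; lra.
  have p2 : p ^+ 2 <= (d + e) ^+ 2 by rewrite lerXn2r ?nnegrE; lra.
  have q2 : q ^+ 2 <= (d + e) ^+ 2 by rewrite lerXn2r ?nnegrE; lra.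
  rewrite exprMn => eq; move: m2 p2 q2 eq.
  rewrite sqrrD; lra.
pose F := filter_from [set e : R | 0 < e] B.
have FF : ProperFilter F.
  apply: filter_from_proper => //; apply: filter_from_filter; first by exists 1 => /=.
  move=> i j /= i0 j0; exists (Num.min i j) => /=; first by rewrite lt_min i0 j0.
  by move=> k [Kk]; rewrite -ltrBlDl lt_min => /andP[ki kj];
    split; split=> //; rewrite -ltrBlDl.
have cF : cauchy F.
  apply: cauchy_exP => eps /gt0_Re[]; set e := complex.Re eps => e0 ->.
  pose c := Num.min 1 (e ^+ 2 / (8 * d + 8)).
  have cp : 0 < e ^+ 2 / (8 * d + 8) by rewrite divr_gt0 ?exprn_gt0//; lra.
  have c0 : 0 < c by rewrite lt_min ltr01.
  have [k Bk] := B_ex _ c0.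
  exists k; exists c => //= k' Bk'.
  rewrite -ball_normE /= normRE ltcR.
  rewrite -(@ltr_pXn2r _ 2) ?nnegrE ?normR_ge0 ?(ltW e0)//.
  apply: (le_lt_trans (dist _ _ _ c0 Bk Bk')).
  have c1 : c <= 1 by rewrite ge_min lexx.
  have : c * (8 * d + 8) <= e ^+ 2.
    by rewrite -ler_pdivlMr; [rewrite ge_min lexx orbT|lra].
  nra.
have [y Fy] : exists y, F --> y by apply/cvg_ex; exact: cauchy_cvg.
have near_y (e : R) : 0 < e -> exists2 k, B e k & normR (y - k) < e.
  move=> e0.
  have Fb : F (ball y e%:C) by apply: Fy; apply: nbhsx_ballx; rewrite ltcR.
  have FB : F (B e) by exists e.
  have [k [Bk]] := filter_ex (filterI FB Fb).
  by rewrite -ball_normE /= normRE ltcR; exists k.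
have Ky : K y.
  apply: clK => U /nbhs_ballP[eps /= /gt0_Re[e0 ->] sub].
  have [k [Kk _] yk] := near_y _ e0.
  exists k; split=> //; apply: sub.
  by rewrite -ball_normE /= normRE ltcR.
have yd : normR (x - y) <= d.
  apply/ler_addgt0Pr => e e0.
  have [k [Kk xk] yk] := near_y (e / 2) (divr_gt0 e0 (ltr0n _ 2)).
  apply: (le_trans (normR_triangle x k y)).
  rewrite normR_sub in yk; lra.
exists y => // z Kz.
have [->|z0] := eqVneq z 0; first by rewrite linear0r.
set w := x - y.
pose t := inner w z / `|z| ^+ 2.
have : normR w <= normR (w - t *: z).
  apply: (le_trans yd); rewrite -addrA -opprD; apply: d_le.
  by rewrite addrC; apply: Klin.
rewrite -lecR -!normRE -(@ler_pXn2r _ 2) ?nnegrE// norm_sub_proj//.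
rewrite lerBrDr gerDl.
rewrite pmulr_lle0 ?invr_gt0 ?exprn_gt0 ?normr_gt0// => h.
have : `|inner w z| ^+ 2 == 0 by rewrite eq_le h exprn_ge0.
by rewrite expf_eq0 normr_eq0 => /eqP.
Qed.

Lemma riesz (phi : H -> R[i]) (M : R) :
  (forall a x y, phi (a *: x + y) = a * phi x + phi y) ->
  (forall x, `|phi x| <= M%:C * `|x|) ->
  exists y, forall x, phi x = inner x y.
Proof.
move=> lin bnd.
have phi0 : phi 0 = 0.
  by apply/eqP; rewrite -normr_le0; have := bnd 0; rewrite normr0 mulr0.
have phiB x y : phi (x - y) = phi x - phi y.
  by rewrite addrC -scaleN1r lin mulN1r addrC.
pose K := [set x | phi x = 0].
have clK : closed K.
  move=> p clp; rewrite /K /=; apply/eqP; rewrite -normr_le0.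
  have [N N0 bN] : exists2 N : R, 0 < N & forall x, `|phi x| <= N%:C * `|x|.
    exists (Num.max M 1); first by rewrite lt_max ltr01 orbT.
    by move=> x; apply: (le_trans (bnd x)); rewrite ler_wpM2r// lecR le_max lexx.
  apply: contraT => pp0.
  have pp : 0 < `|phi p| by rewrite normr_gt0 -normr_le0.
  have NC : 0 < N%:C :> R[i] by rewrite ltcR.
  have pN : 0 < `|phi p| / N%:C by rewrite divr_gt0.
  have [k [Kk]] := clp _ (nbhsx_ballx p _ pN).
  rewrite -ball_normE /= ltr_pdivlMr// mulrC => pk.
  have := le_lt_trans (bN (p - k)) pk.
  by rewrite phiB Kk subr0 ltxx.
have Klin a y z : K y -> K z -> K (a *: y + z).
  by rewrite /K /= lin => -> ->; rewrite mulr0 addr0.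
have [allK|] := pselect (forall x, phi x = 0).
  by exists 0 => x; rewrite linear0r.
move=> /existsNP[x0 /eqP px0].
have [y Ky orth] := orth_proj_ex x0 clK phi0 Klin.
set z := x0 - y in orth.
have pz : phi z != 0 by rewrite phiB Ky subr0.
have z0 : z != 0 by apply: contraNneq pz => ->; rewrite phi0.
have zz0 : inner z z != 0 by rewrite -normr_inner expf_neq0 ?normr_eq0.
exists (Num.conj (phi z / inner z z) *: z) => x.
rewrite innerZr conjCK.
have : inner z (x - (phi x / phi z) *: z) = 0.
  by apply: orth; rewrite /K /= phiB -[_ *: z]addr0 lin phi0 addr0 divfK// subrr.
rewrite innerC => /(congr1 Num.conj); rewrite conjCK conjC0.
rewrite innerDl innerNl innerZl => /eqP; rewrite subr_eq0 => /eqP ->.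
by field; rewrite pz zz0.
Qed.

End HilbertTheory.

Section BoundedOperators.
Context {R : realType} {H : hilbertType R}.

Definition bounded_linear : {pred H -> H} :=
  [pred f : H -> H | `[< linear f /\ continuous f >]].

Lemma bounded_linearP (f : H -> H) :
  reflect (linear f /\ continuous f) (f \in bounded_linear).
Proof. exact: asboolP. Qed.

Lemma bounded_linear_submod : submod_closed bounded_linear.
Proof.
split=> [|a f g /bounded_linearP[fl fc] /bounded_linearP[gl gc]];
    apply/bounded_linearP; split.
- by move=> a x y; rewrite /GRing.zero/= scaler0 addr0.
- exact: cst_continuous.
- move=> b x y; rewrite !fctE fl gl !scalerDr !scalerA addrACA.
  by rewrite (mulrC b a).
- move=> x; apply: (@continuousD _ _ _ (a \*: f) g); last exact: gc.
  exact: (@continuousZl_tmp _ _ _ (f : H -> H) a x (fc x)).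
Qed.

HB.instance Definition _ :=
  GRing.isSubmodClosed.Build R[i] (H -> H) bounded_linear bounded_linear_submod.

End BoundedOperators.

Record bounded_op (R : realType) (H : hilbertType R) := BoundedOp {
  bounded_op_fun :> H -> H;
  bounded_opP : bounded_op_fun \in bounded_linear }.

Notation "''B' ( H )" := (bounded_op H)
  (at level 8, format "''B' ( H )") : type_scope.

HB.instance Definition _ (R : realType) (H : hilbertType R) :=
  [isSub for @bounded_op_fun R H].

HB.instance Definition _ (R : realType) (H : hilbertType R) :=
  [Choice of 'B(H) by <:].

HB.instance Definition _ (R : realType) (H : hilbertType R) :=
  [SubChoice_isSubLmodule of 'B(H) by <:].

Definition op_norm (R : realType) (H : hilbertType R) (f : 'B(H)) : R :=
  sup [set normR (f x) | x in [set x | normR x <= 1]].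

Section OperatorNorm.
Context {R : realType} {H : hilbertType R}.
Implicit Types (f g : 'B(H)) (x y : H).

Lemma bounded_op_linear f : linear f.
Proof. by have /bounded_linearP[] := bounded_opP f. Qed.

HB.instance Definition _ f :=
  GRing.isLinear.Build R[i] H H _ f (bounded_op_linear f).

Lemma bounded_opE f g : f =1 g -> f = g.
Proof. by move=> fg; apply: val_inj; apply/funext. Qed.

Lemma normR_eq0 x : (normR x == 0) = (x == 0).
Proof. by rewrite -(inj_eq (@complexI R)) -normRE normr_eq0. Qed.

Lemma normRN x : normR (- x) = normR x.
Proof. by rewrite /normR normrN. Qed.

Lemma normRD x y : normR (x + y) <= normR x + normR y.
Proof. by have := normR_triangle x 0 (- y); rewrite opprK subr0 add0r. Qed.

Lemma Re_norm_real (r : R) : complex.Re `|r%:C| = `|r|.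
Proof. by rewrite /= expr0n /= addr0 sqrtr_sqr. Qed.

Lemma bounded_op_bound f :
  exists2 M : R, 0 <= M & forall x, normR (f x) <= M * normR x.
Proof.
have /bounded_linearP[_ fc] := bounded_opP f.
have /linear_bounded_continuous/linear_boundedP :
  continuous (f : {linear H -> H}) := fc.
move=> /pinfty_ex_gt0[M /gt0_Re[M0 ->] bM].
exists (complex.Re M); first exact: ltW.
by move=> x; have := bM x; rewrite !normRE -rmorphM lecR.
Qed.

Lemma bounded_opI (h : H -> H) (M : R) : linear h ->
  (forall x, normR (h x) <= M * normR x) -> h \in bounded_linear.
Proof.
move=> hl hM; apply/bounded_linearP; split=> //.
pose h' : {linear H -> H} := HB.pack h (GRing.isLinear.Build R[i] H H _ h hl).
suff : continuous h' by [].
apply/linear_bounded_continuous/linear_boundedP.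
exists (Num.max M 0)%:C; split; first by rewrite complex_real.
move=> r Mr x; apply: (@le_trans _ _ ((Num.max M 0)%:C * `|x|)).
  rewrite !normRE -rmorphM lecR; apply: (le_trans (hM x)).
  by rewrite ler_wpM2r ?normR_ge0// le_max lexx.
by rewrite ler_wpM2r// ltW.
Qed.

Lemma op_norm_sup f : has_sup [set normR (f x) | x in [set x | normR x <= 1]].
Proof.
split; first by exists (normR (f 0)), 0 => //=; rewrite (eqP (_ : normR 0 == 0)) ?normR_eq0.
have [M M0 fM] := bounded_op_bound f.
by exists M => _ [x /= x1 <-]; rewrite (le_trans (fM x))// ler_piMr.
Qed.

Lemma op_norm_ge0 f : 0 <= op_norm f.
Proof.
apply: (le_trans (normR_ge0 (f 0))); apply: sup_upper_bound; first exact: op_norm_sup.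
by exists 0 => //=; rewrite (eqP (_ : normR 0 == 0)) ?normR_eq0.
Qed.

Lemma op_normP f x : normR (f x) <= op_norm f * normR x.
Proof.
have [->|x0] := eqVneq x 0.
  by rewrite linear0 (eqP (_ : normR 0 == 0)) ?normR_eq0// mulr0.
have nx0 : 0 < normR x by rewrite lt_neqAle eq_sym normR_eq0 x0 normR_ge0.
rewrite -ler_pdivrMr//; apply: sup_upper_bound; first exact: op_norm_sup.
exists ((normR x)^-1%:C *: x) => /=.
  by rewrite normRZ Re_norm_real ger0_norm ?invr_ge0 ?normR_ge0// mulVf// gt_eqF.
by rewrite linearZ/= normRZ Re_norm_real ger0_norm ?invr_ge0 ?normR_ge0// mulrC.
Qed.

Lemma op_norm_le f (M : R) : 0 <= M ->
  (forall x, normR (f x) <= M * normR x) -> op_norm f <= M.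
Proof.
move=> M0 fM; apply: ge_sup; first exact: (op_norm_sup f).1.
by move=> _ [x /= x1 <-]; rewrite (le_trans (fM x))// ler_piMr.
Qed.

Lemma op_normD f g : op_norm (f + g) <= op_norm f + op_norm g.
Proof.
apply: op_norm_le => [|x]; first by rewrite addr_ge0 ?op_norm_ge0.
by rewrite mulrDl (le_trans (normRD _ _))// lerD ?op_normP.
Qed.

Lemma op_normZ (a : R[i]) f : op_norm (a *: f) = complex.Re `|a| * op_norm f.
Proof.
have a0 (b : R[i]) : 0 <= complex.Re `|b|.
  by rewrite -ler0c RRe_real ?normr_real.
have le (b : R[i]) g : op_norm (b *: g) <= complex.Re `|b| * op_norm g.
  apply: op_norm_le => [|x]; first by rewrite mulr_ge0 ?op_norm_ge0.
  by rewrite normRZ -mulrA ler_wpM2l ?op_normP.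
have [->|an0] := eqVneq a 0.
  rewrite normr0 mul0r scale0r; apply/eqP; rewrite eq_le op_norm_ge0 andbT.
  apply: op_norm_le => // x; rewrite mul0r.
  by rewrite (eqP (_ : normR _ == 0)) ?normR_eq0.
apply/eqP; rewrite eq_le le andTb.
have := le a^-1 (a *: f); rewrite scalerA mulVf// scale1r => h.
have na0 : 0 < complex.Re `|a| by rewrite -ltcR RRe_real ?normr_real// normr_gt0.
rewrite mulrC -ler_pdivlMr// mulrC; apply: (le_trans h).
rewrite le_eqVlt; apply/orP; left; apply/eqP; congr (_ * _).
apply: complexI; rewrite fmorphV !RRe_real ?normr_real//.
by rewrite normfV.
Qed.

Lemma op_norm_eq0 f : op_norm f = 0 -> f = 0.
Proof.
move=> f0; apply: bounded_opE => x /=; apply/eqP.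
by rewrite -normR_eq0 eq_le normR_ge0 (le_trans (op_normP f x))// f0 mul0r.
Qed.

Lemma op_normCD f g : (op_norm (f + g))%:C <= (op_norm f)%:C + (op_norm g)%:C.
Proof. by rewrite -rmorphD lecR op_normD. Qed.

Lemma op_normCZ (a : R[i]) f : (op_norm (a *: f))%:C = `|a| * (op_norm f)%:C.
Proof. by rewrite op_normZ rmorphM; congr (_ * _); exact: RRe_real (normr_real a). Qed.

Lemma op_normC_eq0 f : (op_norm f)%:C = 0 -> f = 0.
Proof. by move=> /complexI/op_norm_eq0. Qed.

End OperatorNorm.

HB.instance Definition _ (R : realType) (H : hilbertType R) :=
  Lmodule_isNormed.Build R[i] 'B(H) op_normCD op_normCZ op_normC_eq0.

Section OperatorAlgebra.
Context {R : realType} {H : hilbertType R}.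
Implicit Types (f g h : 'B(H)) (x y : H).

Lemma normR_op f : normR f = op_norm f.
Proof. by []. Qed.

Lemma cauchy_R (V : normedModType R[i]) (F : set_system V) : ProperFilter F ->
  cauchy F <-> forall e : R, 0 < e -> exists v, F [set w | normR (v - w) < e].
Proof.
move=> FF; split=> [/cauchyP cF e e0|cF].
  have [|v Fv] := cF e%:C; first by rewrite ltcR.
  exists v; apply: filterS Fv => w.
  by rewrite -ball_normE /= normRE ltcR.
apply: cauchy_exP => d /gt0_Re[d0 ->]; have [v Fv] := cF _ d0.
by exists v; apply: filterS Fv => w; rewrite -ball_normE /= normRE ltcR.
Qed.

Lemma cvg_R (V : normedModType R[i]) (F : set_system V) (v : V) : Filter F ->
  F --> v <-> forall e : R, 0 < e -> F [set w | normR (v - w) < e].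
Proof.
move=> FF; split=> [Fv e e0|Fv].
  apply: (@filterS _ F _ (ball v e%:C)).
    by move=> w; rewrite -ball_normE /= normRE ltcR.
  by apply: Fv; apply: nbhsx_ballx; rewrite ltcR.
apply/cvg_ballP => d /gt0_Re[d0 ->]; have Fe := Fv _ d0.
by apply: filterS Fe => w; rewrite -ball_normE /= normRE ltcR.
Qed.

Lemma bounded_op_complete (F : set_system 'B(H)) :
  ProperFilter F -> cauchy F -> cvg F.
Proof.
move=> FF /cauchy_R cF.
have cFx x : cauchy ((fun f : 'B(H) => f x) @ F).
  apply/cauchy_R => e e0.
  have x1 : 0 < normR x + 1 by rewrite ltr_wpDl ?normR_ge0.
  have [v Fv] := cF (e / (normR x + 1)) (divr_gt0 e0 x1).
  exists (v x); change (F [set w : 'B(H) | normR (v x - w x) < e]).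
  apply: filterS Fv => w /= vw.
  have /le_lt_trans : normR (v x - w x) <= op_norm (v - w) * normR x
    by exact: op_normP (v - w) x.
  apply; apply: (@le_lt_trans _ _ (op_norm (v - w) * (normR x + 1))).
    by rewrite ler_wpM2l ?op_norm_ge0// lerDl.
  by rewrite -ltr_pdivlMr.
have /choice[u Fu] : forall x, exists y, (fun f : 'B(H) => f x) @ F --> y.
  move=> x.
  by apply/cvg_ex; exact: cauchy_cvg.
have u_lin : linear u.
  move=> a x y; apply: (@cvg_unique H _ ((fun f : 'B(H) => f (a *: x + y)) @ F)).
  - exact: norm_hausdorff.
  - exact: Fu.
  - have -> : (fun f : 'B(H) => f (a *: x + y)) = (fun f : 'B(H) => a *: f x + f y).
      by apply/funext => f; rewrite linearP.
    by apply: cvgD; [apply: cvgZl_tmp; exact: Fu|exact: Fu].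
have u_near v (e : R) : F [set w : 'B(H) | op_norm (v - w) < e] ->
    forall x, normR (v x - u x) <= e * normR x.
  move=> Fv x; apply/ler_addgt0Pr => d d0.
  have Fd : F [set w : 'B(H) | normR (u x - w x) < d]
    by have /cvg_R/(_ d d0) := Fu x.
  have [w [/= vw uw]] := filter_ex (filterI Fv Fd).
  apply: (le_trans (normR_triangle _ (w x) _)); rewrite lerD//.
    apply: (le_trans (op_normP (v - w) x)).
    by rewrite ler_wpM2r ?normR_ge0// ltW.
  by rewrite normR_sub ltW.
have [v1 Fv1] := cF 1 ltr01.
have u_bnd : u \in bounded_linear.
  apply: (bounded_opI (M := 1 + op_norm v1) u_lin) => x.
  rewrite mulrDl mul1r; have := u_near _ _ Fv1 x; rewrite mul1r => h.
  have -> : u x = - (v1 x - u x) + v1 x by rewrite opprB subrK.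
  by rewrite (le_trans (normRD _ _))// normRN lerD// op_normP.
apply/cvg_ex; exists (BoundedOp u_bnd); apply/cvg_R => e e0.
have e2 : 0 < e / 2 / 2 by rewrite !divr_gt0.
have [v Fv] := cF _ e2.
apply: filterS (Fv) => w /= vw.
apply: (@le_lt_trans _ _ (e / 2)); last by lra.
apply: op_norm_le => [|x]; first lra.
change (normR (u x - w x) <= e / 2 * normR x).
apply: (le_trans (normR_triangle _ (v x) _)).
have h1 := u_near _ _ Fv x.
have h2 := op_normP (v - w) x.
have h3 : op_norm (v - w) * normR x <= e / 2 / 2 * normR x.
  by rewrite ler_wpM2r ?normR_ge0// ltW.
have h4 : normR (v x - w x) <= op_norm (v - w) * normR x by [].
rewrite (normR_sub (u x)); lra.
Qed.

Lemma comp_bounded f g : f \o g \in bounded_linear.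
Proof.
apply: (bounded_opI (M := op_norm f * op_norm g)) => [a x y|x] /=.
  by rewrite !linearP.
rewrite (le_trans (op_normP _ _))// -mulrA ler_wpM2l ?op_norm_ge0//.
exact: op_normP.
Qed.

Definition op_comp f g : 'B(H) := BoundedOp (comp_bounded f g).

Lemma id_bounded : (@idfun H) \in bounded_linear.
Proof. by apply: (bounded_opI (M := 1)) => [//|x]; rewrite mul1r. Qed.

Definition op_id : 'B(H) := BoundedOp id_bounded.

Lemma op_norm_comp f g : op_norm (op_comp f g) <= op_norm f * op_norm g.
Proof.
apply: op_norm_le => [|x]; first by rewrite mulr_ge0 ?op_norm_ge0.
rewrite (le_trans (op_normP f (g x)))// -mulrA ler_wpM2l ?op_norm_ge0//.
exact: op_normP.
Qed.

Lemma innerI x y : (forall z, inner z x = inner z y) -> x = y.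
Proof.
move=> xy; apply/eqP; rewrite -subr_eq0 -normr_eq0 -sqrf_eq0 normr_inner.
by rewrite innerDr innerNr xy subrr.
Qed.

Lemma normR_inner_le x (M : R) : 0 <= M ->
  normR x ^+ 2 <= M * normR x -> normR x <= M.
Proof.
move=> M0; rewrite expr2.
have [->//|x0] := eqVneq (normR x) 0.
by rewrite ler_pM2r// lt_neqAle eq_sym x0 normR_ge0.
Qed.

Lemma normR_sq x : (normR x ^+ 2)%:C = inner x x.
Proof. by rewrite -normr_inner normRE rmorphXn. Qed.

Lemma adjoint_ex f : exists g, forall x y, inner (f x) y = inner x (g y).
Proof.
have /choice[u fu] : forall y, exists z, forall x, inner (f x) y = inner x z.
  move=> y.
  apply: (@riesz _ _ (fun x => inner (f x) y) (op_norm f * normR y)) => [a x z|x].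
    by rewrite linearP innerDl innerZl.
  rewrite (le_trans (inner_CauchySchwarz _ _))// !normRE -!rmorphM lecR.
  by rewrite mulrAC ler_wpM2r ?normR_ge0// op_normP.
have u_lin : linear u.
  move=> a x y; apply: innerI => z.
  by rewrite innerDr innerZr -!fu innerDr innerZr.
have u_bnd : u \in bounded_linear.
  apply: (bounded_opI (M := op_norm f) u_lin) => y.
  apply: normR_inner_le; first by rewrite mulr_ge0 ?op_norm_ge0 ?normR_ge0.
  rewrite -lecR normR_sq -fu.
  apply: (le_trans (real_ler_norm _)).
    by rewrite fu -normR_sq complex_real.
  rewrite (le_trans (inner_CauchySchwarz _ _))// !normRE -!rmorphM lecR.
  by rewrite mulrAC ler_wpM2r ?normR_ge0// op_normP.
by exists (BoundedOp u_bnd) => x y; exact: fu.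
Qed.

Definition adjoint f : 'B(H) := projT1 (cid (adjoint_ex f)).

Lemma adjointP f x y : inner (f x) y = inner x (adjoint f y).
Proof. exact: (projT2 (cid (adjoint_ex f)) x y). Qed.

Lemma adjoint_eq f g :
  (forall x y, inner (f x) y = inner x (g y)) -> adjoint f = g.
Proof.
by move=> fg; apply: bounded_opE => y; apply: innerI => z; rewrite -adjointP fg.
Qed.

Lemma adjointK : involutive adjoint.
Proof.
by move=> f; apply: adjoint_eq => x y; rewrite innerC -adjointP -innerC.
Qed.

Lemma adjointD : {morph adjoint : f g / f + g}.
Proof.
move=> f g; apply: adjoint_eq => x y.
change (inner (f x + g x) y = inner x (adjoint f y + adjoint g y)).
by rewrite innerDl innerDr -!adjointP.
Qed.

Lemma adjointZ (a : R[i]) f : adjoint (a *: f) = Num.conj a *: adjoint f.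
Proof.
apply: adjoint_eq => x y.
change (inner (a *: f x) y = inner x (Num.conj a *: adjoint f y)).
by rewrite innerZl innerZr conjCK -adjointP.
Qed.

Lemma adjoint_comp f g :
  adjoint (op_comp f g) = op_comp (adjoint g) (adjoint f).
Proof. by apply: adjoint_eq => x y /=; rewrite !adjointP. Qed.

Lemma op_norm_sq f : op_norm f ^+ 2 <= op_norm (op_comp (adjoint f) f).
Proof.
set N := op_norm (op_comp _ _).
have N0 : 0 <= N by exact: op_norm_ge0.
rewrite -[leRHS]sqr_sqrtr// lerXn2r ?nnegrE ?op_norm_ge0 ?sqrtr_ge0//.
apply: op_norm_le => [|x]; first exact: sqrtr_ge0.
rewrite -(@ler_pXn2r _ 2) ?nnegrE ?mulr_ge0 ?normR_ge0 ?sqrtr_ge0//.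
rewrite exprMn sqr_sqrtr// -lecR normR_sq adjointP.
apply: (le_trans (real_ler_norm _)).
  by rewrite -adjointP -normR_sq complex_real.
rewrite (le_trans (inner_CauchySchwarz _ _))// !normRE -!rmorphM lecR.
by rewrite mulrC expr2 mulrA ler_wpM2r ?normR_ge0//;
  exact: op_normP (op_comp (adjoint f) f) x.
Qed.

Lemma op_norm_adjoint_le f : op_norm f <= op_norm (adjoint f).
Proof.
have := le_trans (op_norm_sq f) (op_norm_comp (adjoint f) f).
have [->|f0] := eqVneq (op_norm f) 0; first by rewrite op_norm_ge0.
by rewrite expr2 ler_pM2r// lt_neqAle eq_sym f0 op_norm_ge0.
Qed.

Lemma op_norm_cstar f : op_norm (op_comp (adjoint f) f) = op_norm f ^+ 2.
Proof.
apply/eqP; rewrite eq_le op_norm_sq andbT (le_trans (op_norm_comp _ _))//.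
rewrite expr2 ler_wpM2r ?op_norm_ge0//.
by have := op_norm_adjoint_le (adjoint f); rewrite adjointK.
Qed.

Lemma op_compA : associative op_comp.
Proof. by move=> f g h; exact: bounded_opE. Qed.

Lemma op_comp1l : left_id op_id op_comp.
Proof. by move=> f; exact: bounded_opE. Qed.

Lemma op_comp1r : right_id op_id op_comp.
Proof. by move=> f; exact: bounded_opE. Qed.

Lemma op_compDl : left_distributive op_comp +%R.
Proof. by move=> f g h; exact: bounded_opE. Qed.

Lemma op_compDr : right_distributive op_comp +%R.
Proof. by move=> f g h; apply: bounded_opE => x; exact: linearD. Qed.

Lemma op_scalerAl (a : R[i]) f g : a *: op_comp f g = op_comp (a *: f) g.
Proof. exact: bounded_opE. Qed.

Lemma op_scalerAr (a : R[i]) f g : a *: op_comp f g = op_comp f (a *: g).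
Proof. by apply: bounded_opE => x; apply/esym; exact: linearZ. Qed.

Lemma normr_op_comp f g : `|op_comp f g| <= `|f| * `|g|.
Proof. by rewrite !normRE -rmorphM lecR; exact: op_norm_comp. Qed.

Lemma normr_op_cstar f : `|op_comp (adjoint f) f| = `|f| ^+ 2.
Proof. by rewrite !normRE -rmorphXn; congr (_%:C); exact: op_norm_cstar. Qed.

End OperatorAlgebra.

HB.instance Definition _ (R : realType) (H : hilbertType R) :=
  Uniform_isComplete.Build 'B(H) (@bounded_op_complete R H).

HB.instance Definition _ (R : realType) (H : hilbertType R) :=
  isCstarAlgebra.Build R 'B(H) op_compA op_comp1l op_comp1r op_compDl op_compDr
    op_scalerAl op_scalerAr normr_op_comp adjointD adjointZ adjoint_comp
    adjointK normr_op_cstar.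

Section UnitaryTuples.
Context {R : realType}.
Implicit Types A B : cstarAlgType R.

Definition unitary_elt A (x : A) : Prop := star x * x = 1 /\ x * star x = 1.

Definition star_morphism_on A B (S : set A) (phi : A -> B) : Prop :=
  [/\ forall (a : R[i]) x y,
        S x -> S y -> phi (a *: x + y) = a *: phi x + phi y,
      forall x y, S x -> S y -> phi (x * y) = phi x * phi y
    & forall x, S x -> phi (star x) = star (phi x)].

Definition cstar_subalgebra A (S : set A) : Prop :=
  [/\ S 1,
      forall (a : R[i]) x y, S x -> S y -> S (a *: x + y),
      forall x y, S x -> S y -> S (x * y),
      forall x, S x -> S (star x)
    & closed S].

Definition cstar_generated A d (u : 'I_d -> A) : set A :=
  smallest (@cstar_subalgebra A) (range u).

(* The relation u ~ v; [phi] is only relevant on C*(u). *)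
Definition tuple_equiv A B d (u : 'I_d -> A) (v : 'I_d -> B) : Prop :=
  exists phi : A -> B,
    [/\ set_bij (cstar_generated u) (cstar_generated v) phi,
        star_morphism_on (cstar_generated u) phi
      & forall i, phi (u i) = v i].

(* [J] realises the inclusion of H as a closed subspace of K, and [P], seen as
   a map onto H rather than onto J(H), is the orthogonal projection. *)
Definition orthogonal_projection (H K : hilbertType R) (J : H -> K) (P : K -> H)
    : Prop :=
  forall x h, inner (x - J (P x)) (J h) = 0.

(* The relation u -< c v. *)
Definition dilates A B d (u : 'I_d -> A) (c : R) (v : 'I_d -> B) : Prop :=
  exists (H K : hilbertType R) (J : {linear H -> K}) (P : K -> H)
         (U : 'I_d -> 'B(H)) (V : 'I_d -> 'B(K)),
    [/\ isometry inner inner J, orthogonal_projection J P,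
        tuple_equiv U u, tuple_equiv V v
      & forall i h, U i h = P (c%:C *: V i (J h))].

(* The infimum is taken in \bar R, so that it is +oo if there is no such c. *)
Definition dilation_constant A B d (u : 'I_d -> A) (v : 'I_d -> B) : \bar R :=
  ereal_inf [set c%:E | c in [set c : R | 0 < c /\ dilates u c v]].

Definition expi (t : R) : R[i] := cos t +i* sin t.

Definition noncommutative_torus_relations A d (Theta : 'M[R]_d) (u : 'I_d -> A)
    : Prop :=
  (forall k, unitary_elt (u k)) /\
  (forall k l, u l * u k = expi (Theta k l) *: (u k * u l)).

(* (A, u) is the universal C*-algebra A_Theta with its generators u_Theta;
   uniqueness of the morphisms follows from generation. *)
Definition noncommutative_torus A d (Theta : 'M[R]_d) (u : 'I_d -> A) : Prop :=
  [/\ noncommutative_torus_relations Theta u,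
      cstar_generated u = setT
    & forall (B : cstarAlgType R) (v : 'I_d -> B),
        noncommutative_torus_relations Theta v ->
        exists phi : A -> B,
          [/\ phi 1 = 1, star_morphism_on setT phi
            & forall k, phi (u k) = v k]].

End UnitaryTuples.

(* Main.v *)
(* Let N be the norm of the sum of the u_k + u_k^*, and let L_k be the twisted
   left regular representation of A_Theta on l^2(Z^d).

   All representations used are faithful because Z^d has polynomial growth: if
   a is a selfadjoint noncommutative polynomial, then a^m has O(m^d) monomials,
   so that |a|^m = |a^m| is at most O(m^(d/2)) times the l^2-norm of the
   coefficients of a^m, which is at most the norm of the image of a^m in any
   representation sending the monomials to an orthonormal family.

   Lower bound: if U = P c V J with V commuting, then tensoring with L (indexed
   in reverse order, which changes the sign of Theta) turns U into commuting
   unitaries X generating a copy of C(T^d), for which the sum of the X_k + X_k^*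
   has norm 2d, and turns V into unitaries satisfying the relations of A_Theta,
   for which it has norm at most N. Hence 2d <= c N.

   Upper bound: take a unit vector xi at which the quadratic form of the sum of
   the L_k + L_k^* is close to N in absolute value. The automorphism
   u_1 -> u_2 -> ... -> u_d -> u_1^* of A_Theta has order 2d; averaging the state
   of xi over it gives a state with the same value r close to N / 2d on all
   generators. Compressing to it the second factor of the commuting tuple
   L_k (x) L_(d-1-k) yields r L_k, so that u is dilated by (1 / r) u_0. *)

Require Import Defs.
From HB Require Import structures.
From mathcomp Require Import finmap.
From mathcomp Require Import all_boot all_order all_algebra sesquilinear complex.
From mathcomp Require Import all_classical all_reals all_analysis.
From mathcomp Require Import ring lra zify.

Set Implicit Arguments.
Unset Strict Implicit.
Unset Printing Implicit Defensive.

Import Order.TTheory GRing.Theory Num.Theory.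
Import numFieldNormedType.Exports.

Local Open Scope classical_set_scope.
Local Open Scope ring_scope.
Local Open Scope complex_scope.

(** * Inner products from minimal data, and the complex line as a Hilbert space *)

Section DotPack.
Context {R : realType} (E : lmodType R[i]) (f : E -> E -> R[i]).
Hypothesis fP : forall a x y z, f (a *: x + y) z = a * f x z + f y z.
Hypothesis fC : forall x y, f x y = Num.conj (f y x).
Hypothesis f_gt0 : forall x, x != 0 -> 0 < f x x.

Let fPr a x y z : f x (a *: y + z) = Num.conj a * f x y + f x z.
Proof. by rewrite fC fP rmorphD rmorphM /= (fC x y) (fC x z). Qed.

Let f_zml z : zmod_morphism (f ^~ z).
Proof. by move=> x y; rewrite /= addrC -scaleN1r fP mulN1r addrC. Qed.
Let f_zmr z : zmod_morphism (f z).
Proof. by move=> x y; rewrite /= addrC -scaleN1r fPr rmorphN1 mulN1r addrC. Qed.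
Let f0l z : f 0 z = 0.
Proof. by rewrite -(subrr 0) f_zml subrr. Qed.
Let f0r z : f z 0 = 0.
Proof. by rewrite -(subrr 0) f_zmr subrr. Qed.
Let f_scl z : scalable_for *%R (f ^~ z).
Proof. by move=> a x; rewrite -[a *: x]addr0 fP f0l addr0. Qed.
Let f_scr z : scalable_for (Num.conj \; *%R) (f z).
Proof. by move=> a x; rewrite -[a *: x]addr0 fPr f0r addr0. Qed.
Let f_herm x y : f x y = (-1) ^+ false * Num.conj (f y x).
Proof. by rewrite expr0 mul1r. Qed.

(** Conjugate-linearity in the second variable is derived from [fP] and [fC], so a new inner product
    only has to be checked for left linearity, conjugate symmetry and positivity. *)
Definition dot_pack : {dot E for Num.conj} :=
  HB.pack f (isBilinear.Build _ _ _ _ _ _ f f_zml f_zmr f_scl f_scr)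
    (isHermitianSesquilinear.Build _ _ _ _ f f_herm)
    (isDotProduct.Build _ _ f f_gt0).

End DotPack.

(* A copy of [R[i]]: the completeness instance of MathComp-Analysis on
   [R^o] for [R : realType] prevents declaring one on [(R[i])^o]. *)
Definition complex_line (R : realType) : Type := (R[i])^o.

HB.instance Definition _ (R : realType) :=
  NormedModule.copy (complex_line R) (R[i])^o.

Section ComplexHilbert.
Context {R : realType}.
Notation C := (complex_line R).

Lemma normcE_sqr (x : R[i]) :
  complex.Re `|x| ^+ 2 = complex.Re x ^+ 2 + complex.Im x ^+ 2.
Proof. by rewrite normc_def /= sqr_sqrtr// addr_ge0 ?sqr_ge0. Qed.

Lemma Re_norm_ge0 (x : R[i]) : 0 <= complex.Re `|x|.
Proof. by rewrite normc_def /= sqrtr_ge0. Qed.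

Lemma Re_le_norm (x : R[i]) : `|complex.Re x| <= complex.Re `|x|.
Proof.
rewrite -(@ler_pXn2r _ 2) ?nnegrE ?Re_norm_ge0// normcE_sqr -normrX.
by rewrite ger0_norm ?sqr_ge0// lerDl sqr_ge0.
Qed.

Lemma Im_le_norm (x : R[i]) : `|complex.Im x| <= complex.Re `|x|.
Proof.
rewrite -(@ler_pXn2r _ 2) ?nnegrE ?Re_norm_ge0// normcE_sqr -normrX.
by rewrite ger0_norm ?sqr_ge0// lerDr sqr_ge0.
Qed.

(** Real and imaginary parts do not increase the modulus, so both push [F] to a Cauchy filter of
    [R]; the two real limits are then reassembled. *)
Lemma complex_complete (F : set_system C) : ProperFilter F -> cauchy F -> cvg F.
Proof.
move=> FF /cauchy_R cF.
have part (p : R[i] -> R) : (forall x y, p (x - y) = p x - p y) ->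
   (forall x, `|p x| <= complex.Re `|x|) -> exists l : R, (p : C -> R) @ F --> l.
  move=> pB pb; exists (lim ((p : C -> R) @ F)); apply: cauchy_cvg; apply: cauchy_exP => e e0.
  have [v Fv] := cF e e0; exists (p v).
  change (F [set w : C | ball (p v) e (p w)]).
  apply: filterS Fv => w; rewrite /= /ball/= -pB; apply: le_lt_trans.
  exact: pb.
have [a Fa] := part (@complex.Re R) (fun x y => ltac:(by case: x y => [? ?] [? ?])) Re_le_norm.
have [b Fb] := part (@complex.Im R) (fun x y => ltac:(by case: x y => [? ?] [? ?])) Im_le_norm.
apply/cvg_ex; exists (a +i* b : C); apply/cvg_R => e e0.
have e2 : 0 < e / 2 by rewrite divr_gt0.
have {}Fa : F [set w : C | `|a - complex.Re w| < e / 2].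
  by move: Fa => /cvgrPdist_lt/(_ _ e2).
have {}Fb : F [set w : C | `|b - complex.Im w| < e / 2].
  by move: Fb => /cvgrPdist_lt/(_ _ e2).
apply: filterS (filterI Fa Fb) => -[x y] [/= ha hb].
rewrite /normR -(@ltr_pXn2r _ 2) ?nnegrE ?(ltW e0)//; last exact: Re_norm_ge0.
rewrite normcE_sqr /=.
move: ha hb; rewrite -![ `|_| < _](@ltr_pXn2r _ 2) ?nnegrE ?(ltW e2)// ![ `|_| ^+ 2]real_normK
  ?num_real//.
nra.
Qed.

HB.instance Definition _ := Uniform_isComplete.Build C complex_complete.

Definition cinner (x y : R[i]) : R[i] := x * Num.conj y.

Lemma cinnerP (a x y z : R[i]) : cinner (a * x + y) z = a * cinner x z + cinner y z.
Proof. by rewrite /cinner mulrDl mulrA. Qed.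
Lemma cinnerC (x y : R[i]) : cinner x y = Num.conj (cinner y x).
Proof. by rewrite /cinner rmorphM /= conjCK mulrC. Qed.
Lemma cinner_gt0 (x : R[i]) : x != 0 -> 0 < cinner x x.
Proof. by move=> x0; rewrite /cinner -normCK exprn_gt0 ?normr_gt0. Qed.
Lemma normr_cinner (x : R[i]) :
  `|x| ^+ 2 = dot_pack
    (cinnerP : forall a (x y z : C), cinner (a *: x + y) z = _)
    cinnerC cinner_gt0 x x.
Proof. by rewrite normCK. Qed.

HB.instance Definition _ := isHilbert.Build R C normr_cinner.
End ComplexHilbert.

(** * Contractivity of unital star-morphisms *)

Lemma conj_realC (R : realType) (r : R) : Num.conj r%:C = r%:C :> R[i].
Proof. by rewrite conj_Creal// complex_real. Qed.

Section NormR.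
Context {R : realType} {V : normedModType R[i]}.
Implicit Types x y z : V.

Lemma normR_add x y : normR (x + y) <= normR x + normR y.
Proof. by rewrite -lecR rmorphD/= -!normRE; exact: ler_normD. Qed.

Lemma normR_opp x : normR (- x) = normR x.
Proof. by rewrite /normR normrN. Qed.

Lemma normR_distC x y : normR (x - y) = normR (y - x).
Proof. by rewrite /normR distrC. Qed.

Lemma normR_dist_add z x y : normR (x - y) <= normR (x - z) + normR (z - y).
Proof. by rewrite -[in leLHS](subrK z x) -addrA; exact: normR_add. Qed.

Lemma normR_zero : normR (0 : V) = 0.
Proof. by rewrite /normR normr0. Qed.

Lemma normR_eq0P x : normR x = 0 -> x = 0.
Proof. by move=> x0; apply: normr0_eq0; rewrite normRE x0. Qed.

Lemma normR_scale (a : R[i]) x : normR (a *: x) = normR (a : complex_line R) * normR x.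
Proof. exact: normRZ. Qed.

Lemma normR_scale1 (a : R[i]) x : `|a| = 1 -> normR (a *: x) = normR x.
Proof. by move=> a1; rewrite normRZ a1 mul1r. Qed.

Lemma normR_scaleR (r : R) x : normR (r%:C *: x) = `|r| * normR x.
Proof. by rewrite normRZ Re_norm_real. Qed.

Lemma normR_sum (I : Type) (s : seq I) (P : pred I) (F : I -> V) :
  normR (\sum_(i <- s | P i) F i) <= \sum_(i <- s | P i) normR (F i).
Proof.
elim/big_rec2 : _ => [|i a b _ ab]; first by rewrite normR_zero.
by rewrite (le_trans (normR_add _ _))// lerD2l.
Qed.

Lemma cvg_RP (T : Type) (F : set_system T) {FF : Filter F} (f : T -> V) x :
  f @ F --> x <-> forall e : R, 0 < e -> F [set t | normR (x - f t) < e].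
Proof. exact: cvg_R. Qed.

End NormR.

Section CstarTheory.
Context {R : realType} {A : cstarAlgType R}.
Implicit Types (x y z : A).

Lemma normRM x y : normR (x * y) <= normR x * normR y.
Proof. by rewrite -lecR rmorphM/= -!normRE; exact: cnormM. Qed.

Lemma normR_starM x : normR (star x * x) = normR x ^+ 2.
Proof. by apply: complexI; rewrite rmorphXn/= -!normRE; exact: norm_starM. Qed.

Lemma star_mul x y : star (x * y) = star y * star x.
Proof. exact: starM. Qed.

Lemma star_one : star (1 : A) = 1.
Proof. by rewrite -[LHS]mulr1 -[X in _ * X]starK -star_mul mulr1 starK. Qed.

Lemma star_zero : star (0 : A) = 0.
Proof. by apply: (addrI (star 0)); rewrite -starD !addr0. Qed.

Lemma star_opp x : star (- x) = - star x.
Proof. by rewrite -(scaleN1r x) starZ rmorphN1 scaleN1r. Qed.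

Lemma scale_mull (a : R[i]) x y : (a *: x) * y = a *: (x * y).
Proof. by apply/esym; exact: cscalerAl. Qed.

Lemma scale_mulr (a : R[i]) x y : x * (a *: y) = a *: (x * y).
Proof. by apply/esym; exact: cscalerAr. Qed.

(** The C*-identity and submultiplicativity give |y|^2 <= |star y| |y|; applying this to [star y] as
    well yields equality. *)
Lemma normR_star x : normR (star x) = normR x.
Proof.
have le (y : A) : normR y <= normR (star y).
  have [->|y0] := eqVneq (normR y) 0; first exact: normR_ge0.
  have yp : 0 < normR y by rewrite lt_neqAle eq_sym y0 normR_ge0.
  by rewrite -(ler_pM2r yp) -expr2 -normR_starM normRM.
by apply/eqP; rewrite eq_le le andbT -{2}(starK x) le.
Qed.

Lemma normR_one_le1 : normR (1 : A) <= 1.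
Proof.
have := normR_starM 1; rewrite star_one mulr1.
have := normR_ge0 (1 : A); nra.
Qed.

Lemma unitary_normR_le1 x : unitary_elt x -> normR x <= 1.
Proof.
move=> [x1 _]; have := normR_starM x; rewrite x1.
have := normR_one_le1; have := normR_ge0 x; nra.
Qed.

Lemma normR_starB x y : normR (star x - star y) = normR (x - y).
Proof. by rewrite -star_opp -starD normR_star. Qed.

Lemma selfadjoint_normR_sqr x : star x = x -> normR (x * x) = normR x ^+ 2.
Proof. by move=> sx; rewrite -normR_starM sx. Qed.

Lemma star_exp x n : star (x ^+ n) = star x ^+ n.
Proof. by elim: n => [|n IH]; [exact: star_one|rewrite exprS star_mul IH -exprSr]. Qed.

(** The C*-identity doubles the exponent at each step, hence the powers of two; they suffice for
    extracting roots of arbitrarily high order. *)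
Lemma selfadjoint_normR_exp x k : star x = x ->
  normR (x ^+ (2 ^ k)) = normR x ^+ (2 ^ k).
Proof.
move=> sx; elim: k => [|k IH]; first by rewrite expn0 !expr1.
rewrite expnS mulnC !exprM !expr2 selfadjoint_normR_sqr ?star_exp ?sx//.
by rewrite IH expr2.
Qed.

(** Joint continuity of the product, from [x y - x' y' = x (y - y') + (x - x') y']; taking [r <= 1]
    keeps the norm of [y'] below that of [y] plus 1. *)
Lemma mul_near x y (e : R) : 0 < e -> exists2 r : R, 0 < r &
  forall x' y', normR (x - x') < r -> normR (y - y') < r -> normR (x * y - x' * y') < e.
Proof.
move=> e0; pose M := normR x + normR y + 1.
have M0 : 0 < M by rewrite ltr_wpDl ?addr_ge0 ?normR_ge0.
pose r := Num.min 1 (e / (2 * M)).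
have r0 : 0 < r by rewrite lt_min ltr01 divr_gt0// mulr_gt0.
exists r => // x' y' h1 h2.
have -> : x * y - x' * y' = x * (y - y') + (x - x') * y'.
  by rewrite mulrBr mulrBl addrA subrK.
apply: (le_lt_trans (normR_add _ _)).
have h3 := normRM x (y - y'); have h4 := normRM (x - x') y'.
have h5 : normR y' <= normR y + r.
  have -> : y' = y - (y - y') by rewrite subKr.
  by rewrite (le_trans (normR_add _ _))// normR_opp lerD2l ltW.
have r1 : r <= 1 by rewrite ge_min lexx.
have r2 : r * (2 * M) <= e by rewrite -ler_pdivlMr ?mulr_gt0// ge_min lexx orbT.
have := normR_ge0 x; have := normR_ge0 y; have := normR_ge0 y'.
have := normR_ge0 (x - x'); have := normR_ge0 (y - y').
move: h1 h2 h3 h4 h5; rewrite /M in r2 M0.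
move: (normR (x * _)) (normR (_ * y')) (normR x) (normR y) (normR y')
  (normR _) (normR _) r2 M0.
move=> p q a b c u v; nra.
Qed.

Section Limits.
Context {T : Type} {F : set_system T} {FF : ProperFilter F}.
Implicit Types (f g : T -> A).

Lemma cvg_star f x : f @ F --> x -> (fun t => star (f t)) @ F --> star x.
Proof.
move=> /cvg_RP fx; apply/cvg_RP => e e0.
by apply: filterS (fx e e0) => t /=; rewrite normR_starB.
Qed.

Lemma cvg_mul f g x y : f @ F --> x -> g @ F --> y ->
  (fun t => f t * g t) @ F --> x * y.
Proof.
move=> /cvg_RP fx /cvg_RP gy; apply/cvg_RP => e e0.
have [r r0 near] := mul_near x y e0.
by apply: filterS (filterI (fx r r0) (gy r r0)) => t [/= h1 h2]; exact: near.
Qed.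

End Limits.

Lemma cvg_eq (u v : nat -> A) x y : u @ \oo --> x -> v @ \oo --> y -> u =1 v -> x = y.
Proof.
move=> ux vy /funext uv; rewrite uv in ux.
by apply: (@cvg_unique A _ (v @ \oo)) => //; exact: norm_hausdorff.
Qed.

(* The limit [z] of [z_(n+1) = (x^2 + z_n^2) / 2] satisfies [(1 - z)^2 = 1 - x^2]. *)
Lemma selfadjoint_sqrt x : star x = x -> normR x < 1 ->
  exists y, [/\ star y = y, x * y = y * x & y * y = 1 - x * x].
Proof.
move=> sx x1.
pose h (z : A) : A := (2^-1)%:C *: (x * x + z * z).
pose z n := iter n h 0.
pose s := normR x ^+ 2.
have s0 : 0 <= s by exact: sqr_ge0.
have s1 : s < 1 by rewrite expr_lt1// normR_ge0.
(* The smaller root of [t^2 - 2 t + s], that is, the fixed point in [0, 1[ of the scalar recursion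
   [t -> (s + t^2) / 2] which dominates the norms of the [z n]. *)
pose r := 1 - Num.sqrt (1 - s).
have r2 : r ^+ 2 = 2 * r - s.
  rewrite /r sqrrB sqr_sqrtr ?subr_ge0 ?(ltW s1)//; ring.
have r0 : 0 <= r by rewrite subr_ge0 -[leRHS]sqrtr1 ler_wsqrtr// gerBl.
have r1 : r < 1 by rewrite gtrBl sqrtr_gt0 subr_gt0.
have zE n : z n.+1 = h (z n) by [].
have sz n : star (z n) = z n.
  elim: n => [|n IH]; first exact: star_zero.
  by rewrite zE /h starZ starD !star_mul sx IH conj_realC.
have cz n : x * z n = z n * x.
  elim: n => [|n IH]; first by rewrite mulr0 mul0r.
  rewrite zE /h scale_mull scale_mulr mulrDl mulrDr.
  by rewrite !mulrA IH -[z n * x * _]mulrA IH mulrA.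
have nh (a : A) : normR (h a) <= 2^-1 * (s + normR a ^+ 2).
  rewrite normR_scaleR ger0_norm//; apply: ler_wpM2l => //.
  by rewrite (le_trans (normR_add _ _))// lerD ?(le_trans (normRM _ _)) -?expr2.
have nz n : normR (z n) <= r.
  elim: n => [|n IH]; first by rewrite normR_zero.
  rewrite zE; apply: (le_trans (nh _)).
  have : normR (z n) ^+ 2 <= r ^+ 2 by rewrite lerXn2r ?nnegrE ?normR_ge0.
  rewrite r2; lra.
(* Increments shrink by the factor [r], because both [z n] and [z n.+1] have norm at most [r]. *)
have dh n : normR (z n.+1 - z n) <= r ^+ n * r.
  elim: n => [|n IH]; first by rewrite expr0 mul1r subr0 nz.
  have -> : z n.+2 - z n.+1 =
      (2^-1)%:C *: (z n.+1 * (z n.+1 - z n) + (z n.+1 - z n) * z n).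
    rewrite (zE n.+1) {2}zE [in LHS]/h -scalerBr; congr (_ *: _).
    by rewrite mulrBr mulrBl addrA subrK opprD addrACA subrr add0r.
  rewrite normR_scaleR ger0_norm//.
  apply: (@le_trans _ _ (2^-1 * (2 * r * normR (z n.+1 - z n)))).
    rewrite ler_wpM2l// (le_trans (normR_add _ _))//.
    have -> (t : R) : 2 * r * t = r * t + r * t by ring.
    rewrite lerD//; first by rewrite (le_trans (normRM _ _))// ler_wpM2r ?normR_ge0.
    by rewrite (le_trans (normRM _ _))// mulrC ler_wpM2r ?normR_ge0.
  by rewrite !mulrA mulVf// mul1r exprS -mulrA ler_wpM2l.
have dd n m : normR (z (n + m)%N - z n) <= r ^+ n * (r / (1 - r)).
  have [p p0] : exists p : R, p = (1 - r)^-1 by eexists.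
  have pr : p * (1 - r) = 1 by rewrite p0 mulVf// gt_eqF// subr_gt0.
  have pp : 0 < p by rewrite p0 invr_gt0 subr_gt0.
  (* The sharper bound with the factor [1 - r ^+ m] of a partial geometric sum is what the induction
     on [m] can carry. *)
  suff : normR (z (n + m)%N - z n) <= r ^+ n * r * p * (1 - r ^+ m).
    move=> /le_trans; apply; rewrite -p0 !mulrA ler_piMr//; last first.
      by rewrite gerBl exprn_ge0.
    by rewrite !mulr_ge0 ?exprn_ge0 ?(ltW pp).
  elim: m => [|m IH]; first by rewrite addn0 subrr normR_zero expr0 subrr mulr0.
  rewrite addnS (le_trans (normR_dist_add (z (n + m)%N) _ _))//.
  apply: (le_trans (lerD (dh _) IH)).
  rewrite le_eqVlt; apply/orP; left; apply/eqP.
  transitivity (r ^+ n * r * ((p * (1 - r)) * r ^+ m + p * (1 - r ^+ m))).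
    by rewrite pr exprD; ring.
  by rewrite exprS; ring.
have [l zl] : exists l : A, z @ \oo --> l.
  apply/cvg_ex; apply: cauchy_cvg; apply/cauchy_R => e e0.
  have : (fun n => r ^+ n * (r / (1 - r))) @ \oo --> (0 : R).
    rewrite -[X in _ --> X](mul0r (r / (1 - r))).
    by apply: cvgMr_tmp; apply: cvg_expr; rewrite ger0_norm.
  move=> /cvgrPdist_lt/(_ e e0)[N _ /(_ N (leqnn N))].
  rewrite sub0r normrN ger0_norm; last first.
    by apply: mulr_ge0; [exact: exprn_ge0|apply: divr_ge0 => //; rewrite subr_ge0 ltW].
  move=> Ne; exists (z N); exists N => // n /= Nn.
  rewrite normR_distC -(subnKC Nn); exact: le_lt_trans (dd _ _) Ne.
exists (1 - l).
have zS : (fun n => z n.+1) @ \oo --> l by rewrite cvg_shiftS.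
have sl : star l = l by apply: (cvg_eq (cvg_star zl) zl).
have cl : x * l = l * x.
  by apply: (cvg_eq (cvg_mul (cvg_cst x) zl) (cvg_mul zl (cvg_cst x)) cz).
have el : (2 : R[i]) *: l = x * x + l * l.
  apply: (@cvg_eq (fun n => (2 : R[i]) *: z n.+1) (fun n => x * x + z n * z n)).
  - exact: cvgZl_tmp.
  - by apply: cvgD; [exact: cvg_cst | exact: cvg_mul].
  - move=> n; rewrite zE /h scalerA -[X in X * _](rmorph_nat (@real_complex R)).
    by rewrite -rmorphM divff// scale1r.
split.
- by rewrite starD star_opp star_one sl.
- by rewrite mulrBr mulrBl mulr1 mul1r cl.
- rewrite mulrBl mul1r mulrBr mulr1.
  have -> : l * l = l + l - x * x by rewrite -mulr2n -scaler_nat el addrC addKr.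
  by rewrite opprB [l + l - _ - _]addrAC addrK addrA subrK.
Qed.
End CstarTheory.

Section StarMorphism.
Context {R : realType} {A B : cstarAlgType R} (phi : A -> B).
Hypothesis phi1 : phi 1 = 1.
Hypothesis phiP : star_morphism_on setT phi.
Implicit Types x y : A.

Lemma smorph_lin (a : R[i]) x y : phi (a *: x + y) = a *: phi x + phi y.
Proof. by have [h _ _] := phiP; exact: h. Qed.

Lemma smorphM x y : phi (x * y) = phi x * phi y.
Proof. by have [_ h _] := phiP; exact: h. Qed.

Lemma smorph_star x : phi (star x) = star (phi x).
Proof. by have [_ _ h] := phiP; exact: h. Qed.

Lemma smorphD x y : phi (x + y) = phi x + phi y.
Proof. by have := smorph_lin 1 x y; rewrite !scale1r. Qed.

Lemma smorph0 : phi 0 = 0.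
Proof. by apply: (addrI (phi 0)); rewrite -smorphD !addr0. Qed.

Lemma smorphZ (a : R[i]) x : phi (a *: x) = a *: phi x.
Proof. by rewrite -[a *: x]addr0 smorph_lin smorph0 addr0. Qed.

Lemma smorphN x : phi (- x) = - phi x.
Proof. by rewrite -(scaleN1r x) smorphZ scaleN1r. Qed.

Lemma smorphB x y : phi (x - y) = phi x - phi y.
Proof. by rewrite smorphD smorphN. Qed.

Lemma smorphX x n : phi (x ^+ n) = phi x ^+ n.
Proof. by elim: n => [|n IH]; [exact: phi1|rewrite !exprS smorphM IH]. Qed.

Lemma smorph_sum (I : Type) (s : seq I) (P : pred I) (F : I -> A) :
  phi (\sum_(i <- s | P i) F i) = \sum_(i <- s | P i) phi (F i).
Proof.
elim: s => [|i s IH]; first by rewrite !big_nil smorph0.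
by rewrite !big_cons; case: (P i) => //; rewrite smorphD IH.
Qed.

Lemma smorph_prod (I : Type) (s : seq I) (P : pred I) (F : I -> A) :
  phi (\prod_(i <- s | P i) F i) = \prod_(i <- s | P i) phi (F i).
Proof.
elim: s => [|i s IH]; first by rewrite !big_nil.
by rewrite !big_cons; case: (P i) => //; rewrite smorphM IH.
Qed.

Lemma smorph_unitary x : unitary_elt x -> unitary_elt (phi x).
Proof. by move=> [x1 x2]; split; rewrite -smorph_star -smorphM (x1, x2). Qed.

(* A selfadjoint [x] of norm less than 1 is the real part of the unitary
   [x + i y], where [y^2 = 1 - x^2]. *)
Lemma smorph_selfadjoint_lt1 x : star x = x -> normR x < 1 -> normR (phi x) <= 1.
Proof.
move=> sx x1; have [y [sy xy yy]] := selfadjoint_sqrt sx x1.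
pose w := x + ('i : R[i]) *: y.
have sw : star w = x - ('i : R[i]) *: y.
  by rewrite starD starZ sx sy conjCi scaleNr.
have ii : ('i : R[i]) * 'i = -1 by rewrite -expr2 sqrCi.
have uw : unitary_elt w.
  rewrite /unitary_elt sw /w; split.
    rewrite mulrDr !mulrBl !(scale_mull, scale_mulr) !scalerA ii scaleN1r opprK yy xy.
    by rewrite addrA subrK addrCA subrr addr0.
  rewrite mulrBr !mulrDl !(scale_mull, scale_mulr) !scalerA ii scaleN1r yy xy.
  by rewrite opprD opprK addrA addrK addrCA subrr addr0.
have /smorph_unitary/unitary_normR_le1 uw1 := uw.
have uw2 : normR (phi (star w)) <= 1 by rewrite smorph_star normR_star.
have -> : x = (2^-1)%:C *: (w + star w).
  rewrite sw /w addrACA subrr addr0 -[x + x]/(x *+ 2) -(scaler_nat 2 x) scalerA.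
  by rewrite -[X in _ * X](rmorph_nat (@real_complex R)) -rmorphM mulVf// scale1r.
rewrite smorphZ normR_scaleR ger0_norm// smorphD.
have := normR_add (phi w) (phi (star w)); lra.
Qed.

(** By the C*-identity it suffices to treat selfadjoint elements; these are divided by their norm
    plus [e] to bring the norm strictly below 1. *)
Lemma smorph_contractive x : normR (phi x) <= normR x.
Proof.
suff sa y : star y = y -> normR (phi y) <= normR y.
  rewrite -(@ler_pXn2r _ 2) ?nnegrE ?normR_ge0// -!normR_starM -smorph_star -smorphM.
  by apply: sa; rewrite star_mul starK.
move=> sy; apply/ler_addgt0Pr => e e0.
pose t := normR y + e; have t0 : 0 < t by rewrite ltr_wpDl ?normR_ge0.
have := @smorph_selfadjoint_lt1 (t^-1%:C *: y).
rewrite starZ sy conj_realC smorphZ !normR_scaleR ger0_norm ?invr_ge0 ?(ltW t0)//.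
rewrite !(mulrC t^-1) ltr_pdivrMr// ler_pdivrMr// !mul1r; apply=> //.
by rewrite ltrDl.
Qed.

Lemma smorph_cvg (T : Type) (F : set_system T) {FF : Filter F} (f : T -> A) x :
  f @ F --> x -> (fun t => phi (f t)) @ F --> phi x.
Proof.
move=> /cvg_RP fx; apply/cvg_RP => e e0.
by apply: filterS (fx e e0) => t /=; apply: le_lt_trans; rewrite -smorphB smorph_contractive.
Qed.

End StarMorphism.

(** * The Hilbert space of square summable families *)

Section FinitePartialSums.
Context {I : choiceType}.

(** Finite subsets directed by inclusion: convergence along this filter is unordered summability. *)
Definition fset_filter : set_system {fset I} :=
  filter_from setT (fun A => [set B | (A `<=` B)%fset]).

#[global] Instance fset_filter_proper : ProperFilter fset_filter.
Proof.
eapply filter_from_proper; last by move=> A _; exists A; rewrite /= fsubset_refl.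
apply: filter_fromT_filter; first by exists fset0.
by move=> A B /=; exists (A `|` B)%fset => P /=; rewrite fsubUset => /andP[].
Qed.

End FinitePartialSums.

Section SquareSummable.
Context {R : realType} {I : choiceType} {K : hilbertType R}.
Implicit Types (f g : I -> K) (F : {fset I}).

Definition sqsum f F : R := \sum_(i <- F) normR (f i) ^+ 2.

Lemma sqsum_ge0 f F : 0 <= sqsum f F.
Proof. by apply: sumr_ge0 => i _; rewrite sqr_ge0. Qed.

Lemma sqsum_sub f F F' : (F `<=` F')%fset -> sqsum f F <= sqsum f F'.
Proof.
move=> FF'; rewrite /sqsum (big_fsetID _ (mem F) F') /=.
rewrite (_ : [fset x in F' | x \in F]%fset = F) ?lerDl.
  by apply: sumr_ge0 => i _; rewrite sqr_ge0.
by apply/fsetP => x; rewrite !inE/= andbC; case: (boolP (x \in F)) => //= /(fsubsetP FF').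
Qed.

Definition square_summable : {pred I -> K} :=
  [pred f | `[< exists M, forall F, sqsum f F <= M >]].

Lemma square_summableP f :
  reflect (exists M, forall F, sqsum f F <= M) (f \in square_summable).
Proof. exact: asboolP. Qed.

Lemma square_summable_submod : submod_closed square_summable.
Proof.
split=> [|a f g /square_summableP[M fM] /square_summableP[N gN]];
    apply/square_summableP.
  by exists 0 => F; rewrite /sqsum big1// => i _; rewrite /normR normr0 expr0n.
(* The bound comes from [(p + q)^2 <= 2 p^2 + 2 q^2] at each index. *)
exists (2 * (complex.Re `|a|) ^+ 2 * M + 2 * N) => F.
apply: (@le_trans _ _ (2 * (complex.Re `|a|) ^+ 2 * sqsum f F + 2 * sqsum g F)).
  rewrite /sqsum !mulr_sumr -big_split /=; apply: ler_sum => i _.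
  apply: (@le_trans _ _ ((complex.Re `|a| * normR (f i) + normR (g i)) ^+ 2)).
    rewrite lerXn2r ?nnegrE ?addr_ge0 ?mulr_ge0 ?normR_ge0 ?Re_norm_ge0//.
    by rewrite -normRZ; exact: normRD.
  rewrite -subr_ge0; apply: le_trans (sqr_ge0 (complex.Re `|a| * normR (f i) - normR (g i))) _.
  rewrite -[Normc.normc a]/(complex.Re `|a|) le_eqVlt; apply/orP; left; apply/eqP; ring.
by rewrite lerD ?ler_wpM2l ?mulr_ge0 ?exprn_ge0 ?Re_norm_ge0.
Qed.

HB.instance Definition _ :=
  GRing.isSubmodClosed.Build R[i] (I -> K) square_summable square_summable_submod.

End SquareSummable.

Record ell2 (R : realType) (I : choiceType) (K : hilbertType R) := Ell2 {
  ell2_fun :> I -> K;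
  ell2P : ell2_fun \in square_summable }.

HB.instance Definition _ (R : realType) (I : choiceType) (K : hilbertType R) :=
  [isSub for @ell2_fun R I K].
HB.instance Definition _ (R : realType) (I : choiceType) (K : hilbertType R) :=
  [Choice of ell2 I K by <:].
HB.instance Definition _ (R : realType) (I : choiceType) (K : hilbertType R) :=
  [SubChoice_isSubLmodule of ell2 I K by <:].

Section Ell2Norm.
Context {R : realType} {I : choiceType} {K : hilbertType R}.
Implicit Types (f g h : ell2 I K) (F : {fset I}).

Lemma ell2E f g : f =1 g -> f = g.
Proof. by move=> fg; apply: val_inj; apply/funext. Qed.

Lemma ell2DE f g i : (f + g) i = f i + g i. Proof. by []. Qed.
Lemma ell2ZE a f i : (a *: f) i = a *: f i. Proof. by []. Qed.
Lemma ell20E i : (0 : ell2 I K) i = 0. Proof. by []. Qed.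

Definition sqnorm f : R := sup (range (sqsum f)).

Lemma has_sup_sqsum f : has_sup (range (sqsum f)).
Proof.
split; first by exists (sqsum f fset0), fset0.
by have /square_summableP[M fM] := ell2P f; exists M => _ [F _ <-].
Qed.

Lemma sqsum_le f F : sqsum f F <= sqnorm f.
Proof. by apply: sup_upper_bound; [exact: has_sup_sqsum | exists F]. Qed.

Lemma sqnorm_le f M : (forall F, sqsum f F <= M) -> sqnorm f <= M.
Proof. by move=> fM; apply: ge_sup => [|_ [F _ <-]//]; exact: (has_sup_sqsum f).1. Qed.

Lemma sqnorm_ge0 f : 0 <= sqnorm f.
Proof. exact: le_trans (sqsum_ge0 f fset0) (sqsum_le f _). Qed.

Lemma sqsum_adherent f (e : R) : 0 < e ->
  \forall F \near fset_filter, `|sqnorm f - sqsum f F| < e.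
Proof.
move=> e0; have [_ [F0 _ <-] lt] := sup_adherent e0 (has_sup_sqsum f).
exists F0 => // F /= F0F.
rewrite ger0_norm ?subr_ge0 ?sqsum_le// ltrBlDl -ltrBlDr.
exact: lt_le_trans lt (sqsum_sub _ F0F).
Qed.

Lemma sqnorm_ge f i : normR (f i) ^+ 2 <= sqnorm f.
Proof. by apply: le_trans (sqsum_le f [fset i]%fset); rewrite /sqsum big_seq_fset1. Qed.

Definition ell2_norm f : R := Num.sqrt (sqnorm f).

Lemma ell2_norm_sqr f : ell2_norm f ^+ 2 = sqnorm f.
Proof. by rewrite sqr_sqrtr// sqnorm_ge0. Qed.

Lemma ell2_norm_ge0 f : 0 <= ell2_norm f. Proof. exact: sqrtr_ge0. Qed.

Lemma ell2_norm_le f M : 0 <= M -> (forall F, sqsum f F <= M ^+ 2) -> ell2_norm f <= M.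
Proof.
move=> M0 fM; rewrite -(@ler_pXn2r _ 2) ?nnegrE ?ell2_norm_ge0// ell2_norm_sqr.
exact: sqnorm_le.
Qed.

Lemma ell2_norm_ge f i : normR (f i) <= ell2_norm f.
Proof.
by rewrite -(@ler_pXn2r _ 2) ?nnegrE ?ell2_norm_ge0 ?normR_ge0// ell2_norm_sqr sqnorm_ge.
Qed.

Lemma ell2_norm_eq0 f : ell2_norm f = 0 -> f = 0.
Proof.
move=> f0; apply: ell2E => i; apply/eqP.
by rewrite ell20E -normR_eq0 eq_le normR_ge0 andbT -f0 ell2_norm_ge.
Qed.

Lemma ell2_norm0 : ell2_norm 0 = 0.
Proof.
apply/eqP; rewrite eq_le ell2_norm_ge0 andbT; apply: ell2_norm_le => // F.
by rewrite /sqsum big1 ?expr0n// => i _; rewrite /normR normr0 expr0n.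
Qed.

(* Minkowski's inequality, from [(x + y)^2 <= (1 + t) x^2 + (1 + t^-1) y^2]
   with [t] the quotient of the two norms. *)
Lemma ell2_normD f g : ell2_norm (f + g) <= ell2_norm f + ell2_norm g.
Proof.
set a := ell2_norm f; set b := ell2_norm g.
have a0 : 0 <= a by exact: ell2_norm_ge0.
have b0 : 0 <= b by exact: ell2_norm_ge0.
have [/ell2_norm_eq0 -> |an0] := eqVneq (ell2_norm f) 0.
  by rewrite add0r lerDr.
have [/ell2_norm_eq0 -> |bn0] := eqVneq (ell2_norm g) 0.
  by rewrite addr0 lerDl.
have ap : 0 < a by rewrite lt_neqAle eq_sym an0.
have bp : 0 < b by rewrite lt_neqAle eq_sym bn0.
apply: ell2_norm_le => [|F]; first by rewrite addr_ge0.
pose t := b / a; have tp : 0 < t by rewrite divr_gt0.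
have -> : (a + b) ^+ 2 = (1 + t) * a ^+ 2 + (1 + t^-1) * b ^+ 2.
  by rewrite /t; field; rewrite -/a -/b an0 bn0.
rewrite !ell2_norm_sqr.
apply: (@le_trans _ _ ((1 + t) * sqsum f F + (1 + t^-1) * sqsum g F)); last first.
  by rewrite lerD// ler_wpM2l ?sqsum_le ?addr_ge0 ?invr_ge0 ?(ltW tp).
rewrite /sqsum !mulr_sumr -big_split /=; apply: ler_sum => i _.
apply: (@le_trans _ _ ((normR (f i) + normR (g i)) ^+ 2)).
  by rewrite lerXn2r ?nnegrE ?addr_ge0 ?normR_ge0//; exact: normRD.
rewrite -subr_ge0.
set x := normR (f i); set y := normR (g i).
have -> : (1 + t) * x ^+ 2 + (1 + t^-1) * y ^+ 2 - (x + y) ^+ 2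
  = t^-1 * (t * x - y) ^+ 2 by field; rewrite gt_eqF.
by rewrite mulr_ge0 ?sqr_ge0// invr_ge0 ltW.
Qed.

Lemma sqsumZ (a : R[i]) f F : sqsum (a *: f) F = complex.Re `|a| ^+ 2 * sqsum f F.
Proof.
rewrite /sqsum mulr_sumr; apply: eq_bigr => i _.
by rewrite ell2ZE normRZ exprMn.
Qed.

Lemma ell2_normZ_le (a : R[i]) f : ell2_norm (a *: f) <= complex.Re `|a| * ell2_norm f.
Proof.
apply: ell2_norm_le => [|F]; first by rewrite mulr_ge0 ?Re_norm_ge0 ?ell2_norm_ge0.
rewrite sqsumZ exprMn ell2_norm_sqr; apply: ler_wpM2l; last exact: sqsum_le.
by rewrite exprn_ge0// Re_norm_ge0.
Qed.

Lemma ell2_normZ (a : R[i]) f : ell2_norm (a *: f) = complex.Re `|a| * ell2_norm f.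
Proof.
have [->|an0] := eqVneq a 0; first by rewrite scale0r normr0 mul0r ell2_norm0.
apply/eqP; rewrite eq_le ell2_normZ_le andTb.
have := ell2_normZ_le a^-1 (a *: f); rewrite scalerA mulVf// scale1r => h.
have na0 : 0 < complex.Re `|a| by rewrite -ltcR RRe_real ?normr_real// normr_gt0.
rewrite -ler_pdivlMl//; apply: (le_trans h).
rewrite le_eqVlt; apply/orP; left; apply/eqP; congr (_ * _).
apply: complexI; rewrite fmorphV !RRe_real ?normr_real//.
by rewrite normfV.
Qed.

Lemma ell2_normCD f g : (ell2_norm (f + g))%:C <= (ell2_norm f)%:C + (ell2_norm g)%:C.
Proof. by rewrite -rmorphD lecR ell2_normD. Qed.

Lemma ell2_normCZ (a : R[i]) f : (ell2_norm (a *: f))%:C = `|a| * (ell2_norm f)%:C.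
Proof. by rewrite ell2_normZ rmorphM; congr (_ * _); exact: RRe_real (normr_real a). Qed.

Lemma ell2_normC_eq0 f : (ell2_norm f)%:C = 0 -> f = 0.
Proof. by move=> /complexI/ell2_norm_eq0. Qed.

End Ell2Norm.

HB.instance Definition _ (R : realType) (I : choiceType) (K : hilbertType R) :=
  Lmodule_isNormed.Build R[i] (ell2 I K) ell2_normCD ell2_normCZ ell2_normC_eq0.

Section Ell2Hilbert.
Context {R : realType} {I : choiceType} {K : hilbertType R}.
Implicit Types (f g h : ell2 I K) (F : {fset I}).

Lemma normR_ell2 f : normR f = ell2_norm f.
Proof. by []. Qed.

(** The candidate [u] is the pointwise limit. Bounds for a fixed finite index set pass to this
    limit, which shows first that [v1 - u], hence [u], is square summable, and then that the
    convergence holds in norm. *)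
Lemma ell2_complete (F : set_system (ell2 I K)) :
  ProperFilter F -> cauchy F -> cvg F.
Proof.
move=> FF /cauchy_R cF.
have cFx i : cauchy ((fun f : ell2 I K => f i) @ F).
  apply/cauchy_R => e e0.
  have [v Fv] := cF e e0.
  exists (v i); change (F [set w : ell2 I K | normR (v i - w i) < e]).
  apply: filterS Fv => w /=; apply: le_lt_trans.
  exact: (ell2_norm_ge (v - w) i).
have /choice[u Fu] : forall i : I, exists y : K, (fun f : ell2 I K => f i : K) @ F --> y.
  by move=> i; apply/cvg_ex; exact: cauchy_cvg.
have u_near v (e : R) : 0 < e -> F [set w : ell2 I K | ell2_norm (v - w) < e] ->
    forall S : {fset I}, sqsum ((v : I -> K) - u) S <= e ^+ 2.
  move=> e0 Fv S.
  have cvn i : (fun w : ell2 I K => normR (v i - w i) ^+ 2) @ F --> normR (v i - u i) ^+ 2.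
    suff cvi : (fun w : ell2 I K => normR (v i - w i)) @ F --> normR (v i - u i).
      by under eq_fun do rewrite expr2; rewrite expr2; exact: cvgM.
    apply/cvgrPdist_lt => d d0; have /cvg_R/(_ d d0) := Fu i.
    move=> h; have {}h : F [set w : ell2 I K | normR (u i - w i) < d] := h.
    apply: filterS h => w /=; apply: le_lt_trans.
    rewrite ler_norml; apply/andP; split.
      rewrite lerNl opprB lerBlDl; exact: normR_triangle.
    rewrite lerBlDl (normR_sub (u i)); exact: normR_triangle.
  have cvS : (fun w : ell2 I K => sqsum (v - w) S) @ F --> sqsum ((v : I -> K) - u) S.
    rewrite /sqsum; elim: (enum_fset S) => [|i s IH].
      by under eq_fun do rewrite big_nil; rewrite big_nil; exact: cvg_cst.
    under eq_fun do rewrite big_cons; rewrite big_cons.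
    by apply: cvgD; [exact: cvn | exact: IH].
  apply: (cvgr_to_le cvS); apply: filterS Fv => w /= vw.
  apply: (le_trans (sqsum_le (v - w : ell2 I K) S)); rewrite -ell2_norm_sqr.
  by rewrite lerXn2r ?nnegrE ?ell2_norm_ge0 ?(ltW e0)// ltW.
have [v1 Fv1] := cF 1 ltr01.
have u_sq : u \in square_summable.
  have d_sq : (v1 : I -> K) - u \in square_summable.
    by apply/square_summableP; exists (1 ^+ 2); exact: u_near Fv1.
  by rewrite -[u](subKr (v1 : I -> K)) rpredB// ell2P.
apply/cvg_ex; exists (Ell2 u_sq); apply/cvg_R => e e0.
have e2 : 0 < e / 2 / 2 by rewrite !divr_gt0.
have [v Fv] := cF _ e2.
apply: filterS (Fv) => w /= vw.
have h1 : ell2_norm (v - Ell2 u_sq) <= e / 2 / 2.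
  by apply: ell2_norm_le => [|S]; [exact: ltW | exact: u_near Fv S].
have h2 : ell2_norm (Ell2 u_sq - v) <= e / 2 / 2.
  by rewrite -normR_ell2 /normR distrC.
have := ell2_normD (Ell2 u_sq - v) (v - w); rewrite addrA subrK normR_ell2.
by move/le_lt_trans; apply; rewrite normR_ell2 in vw; lra.
Qed.

Let C := complex_line R.

Lemma polarization (x y : K) : inner x y = 4%:R^-1 *
  (inner (x + y) (x + y) - inner (x - y) (x - y)
   + 'i * (inner (x + 'i *: y) (x + 'i *: y) - inner (x - 'i *: y) (x - 'i *: y))).
Proof.
rewrite !(innerDl, innerDr, innerNl, innerNr, innerZl, innerZr) conjCi.
move: (inner x y) (inner y x) (inner x x) (inner y y) => a b c d.
have ii : ('i : R[i]) ^+ 2 = -1 := sqrCi _.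
apply/eqP; rewrite -subr_eq0; apply/eqP.
transitivity ((1 + 'i ^+ 2) * (2^-1 * (a - b)) : R[i]); last by rewrite ii subrr mul0r.
by field.
Qed.

(** The polarization of the squared norm: the convergence of the sums of inner products then follows
    from the monotone convergence of the sums of squares. *)
Definition ell2_inner f g : R[i] := 4%:R^-1 *
  ((sqnorm (f + g))%:C - (sqnorm (f - g))%:C
   + 'i * ((sqnorm (f + 'i *: g))%:C - (sqnorm (f - 'i *: g))%:C)).

Lemma cvg_sqsum f :
  (fun F => (sqsum f F)%:C : C) @ fset_filter --> ((sqnorm f)%:C : C).
Proof.
apply/cvg_R => e e0; have := sqsum_adherent f e0; apply: filterS => F.
change (`|sqnorm f - sqsum f F| < e ->
  complex.Re `|(sqnorm f)%:C - (sqsum f F)%:C : R[i]| < e).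
by rewrite -rmorphB Re_norm_real.
Qed.

Lemma ell2_polarization f g F : \sum_(i <- F) inner (f i) (g i) = 4%:R^-1 *
  ((sqsum (ell2_fun (f + g)) F)%:C - (sqsum (ell2_fun (f - g)) F)%:C
   + 'i * ((sqsum (ell2_fun (f + 'i *: g)) F)%:C - (sqsum (ell2_fun (f - 'i *: g)) F)%:C)).
Proof.
have sq h : (sqsum h F)%:C = \sum_(i <- F) inner (h i) (h i).
  by rewrite rmorph_sum; apply: eq_bigr => i _; exact: normR_sq.
rewrite !sq -!sumrB mulr_sumr -big_split mulr_sumr; apply: eq_bigr => i _.
exact: polarization.
Qed.

Lemma cvg_cmul (T : Type) (F : set_system T) {FF : Filter F} (k : R[i])
    (a : T -> C) (l : C) :
  a @ F --> l -> (fun x => k * a x : C) @ F --> (k * l : C).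
Proof. by move=> al; apply: (cvgZ (cvg_cst (k : C)) al). Qed.

Lemma ell2_inner_cvg f g :
  (fun F => \sum_(i <- F) inner (f i) (g i) : C) @ fset_filter --> (ell2_inner f g : C).
Proof.
under eq_fun do rewrite ell2_polarization.
have cB h1 h2 : (fun F => (sqsum (ell2_fun h1) F)%:C - (sqsum (ell2_fun h2) F)%:C : C)
    @ fset_filter --> ((sqnorm h1)%:C - (sqnorm h2)%:C : C).
  exact: (cvgB (@cvg_sqsum h1) (@cvg_sqsum h2)).
apply: (@cvg_cmul _ fset_filter _ 4%:R^-1); apply: (@cvgD R[i] C); first exact: cB.
by apply: (@cvg_cmul _ fset_filter _ 'i); exact: cB.
Qed.

Lemma ell2_inner_eq f g (l : C) :
  (fun F => \sum_(i <- F) inner (f i) (g i) : C) @ fset_filter --> l ->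
  ell2_inner f g = l.
Proof.
move=> fgl; apply: (@cvg_unique C _
  ((fun F => \sum_(i <- F) inner (f i) (g i) : C) @ fset_filter)).
- exact: norm_hausdorff.
- exact: ell2_inner_cvg.
- exact: fgl.
Qed.

Lemma ell2_innerP (a : R[i]) f g h :
  ell2_inner (a *: f + g) h = a * ell2_inner f h + ell2_inner g h.
Proof.
apply: (@ell2_inner_eq _ _ (a * ell2_inner f h + ell2_inner g h)).
under eq_fun do rewrite (eq_bigr _ (fun i _ => innerDl (a *: f i) (g i) (h i))) big_split /=.
apply: (@cvgD R[i] C); last exact: ell2_inner_cvg.
under eq_fun do rewrite (eq_bigr _ (fun i _ => innerZl a (f i) (h i))) -mulr_sumr.
apply: (@cvg_cmul _ fset_filter _ a); exact: ell2_inner_cvg.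
Qed.

Lemma ell2_innerC f g : ell2_inner f g = Num.conj (ell2_inner g f).
Proof.
apply: ell2_inner_eq; apply/cvg_RP => e e0.
have /cvg_RP/(_ e e0) h := @ell2_inner_cvg g f; apply: filterS h => F /=.
change (complex.Re `|ell2_inner g f - \sum_(i <- F) inner (g i) (f i) : R[i]| < e ->
  complex.Re `|Num.conj (ell2_inner g f) - \sum_(i <- F) inner (f i) (g i) : R[i]| < e).
rewrite -norm_conjC rmorphB rmorph_sum.
rewrite (eq_bigr (fun i => inner (f i) (g i)))// => i _.
by rewrite [RHS]innerC.
Qed.

Lemma ell2_innerE f : ell2_inner f f = (sqnorm f)%:C.
Proof.
apply: ell2_inner_eq.
have -> : (fun F => \sum_(i <- F) inner (f i) (f i) : C) = (fun F => (sqsum f F)%:C : C).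
  apply/funext => F; rewrite /sqsum rmorph_sum.
  by apply: eq_bigr => i _; rewrite -normR_sq.
exact: cvg_sqsum.
Qed.

Lemma ell2_inner_gt0 f : f != 0 -> 0 < ell2_inner f f.
Proof.
move=> f0; rewrite ell2_innerE ltcR lt_neqAle sqnorm_ge0 andbT eq_sym.
apply: contra f0; rewrite -ell2_norm_sqr sqrf_eq0 => /eqP f0.
by apply/eqP/ell2_norm_eq0.
Qed.

Lemma normr_ell2_inner f :
  `|f| ^+ 2 = dot_pack ell2_innerP ell2_innerC ell2_inner_gt0 f f.
Proof.
transitivity ((ell2_norm f ^+ 2)%:C : R[i]); first by rewrite normRE rmorphXn.
rewrite ell2_norm_sqr; exact/esym/ell2_innerE.
Qed.

HB.instance Definition _ := Uniform_isComplete.Build (ell2 I K) ell2_complete.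
HB.instance Definition _ := isHilbert.Build R (ell2 I K) normr_ell2_inner.

Lemma inner_ell2 f g (l : R[i]) :
  (fun F => \sum_(i <- F) inner (f i) (g i) : C) @ fset_filter --> (l : C) ->
  inner f g = l.
Proof. exact: ell2_inner_eq. Qed.

Lemma inner_ell2_cvg f g :
  (fun F => \sum_(i <- F) inner (f i) (g i) : C) @ fset_filter --> (inner f g : C).
Proof. exact: ell2_inner_cvg. Qed.

End Ell2Hilbert.

(** * Noncommutative monomials *)

Section PhaseEq.
Context {R : realType} {A : cstarAlgType R}.
Implicit Types x y z : A.

(** Working up to a unimodular scalar is enough to count monomials, and avoids recording the cocycle
    produced by reordering a product. *)
Definition phase_eq x y := exists2 a : R[i], `|a| = 1 & x = a *: y.

Lemma phase_eqxx x : phase_eq x x.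
Proof. by exists 1; rewrite ?normr1 ?scale1r. Qed.

Lemma phase_eq_trans y x z : phase_eq x y -> phase_eq y z -> phase_eq x z.
Proof.
move=> [a a1 ->] [b b1 ->]; exists (a * b); last by rewrite scalerA.
by rewrite normrM a1 b1 mulr1.
Qed.

Lemma phase_eq_sym x y : phase_eq x y -> phase_eq y x.
Proof.
move=> [a a1 ->]; exists a^-1; first by rewrite normfV a1 invr1.
by rewrite scalerA mulVf ?scale1r// -normr_eq0 a1 oner_eq0.
Qed.

Lemma phase_eqM x x' y y' :
  phase_eq x x' -> phase_eq y y' -> phase_eq (x * y) (x' * y').
Proof.
move=> [a a1 ->] [b b1 ->]; exists (a * b); first by rewrite normrM a1 b1 mulr1.
by rewrite scale_mull scale_mulr scalerA.
Qed.

Lemma phase_eqMl x y y' : phase_eq y y' -> phase_eq (x * y) (x * y').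
Proof. exact/phase_eqM/phase_eqxx. Qed.

Lemma phase_eqMr x y y' : phase_eq y y' -> phase_eq (y * x) (y' * x).
Proof. by move=> h; apply: phase_eqM => //; exact: phase_eqxx. Qed.

Definition phase_comm x y := phase_eq (x * y) (y * x).

Lemma phase_comm_sym x y : phase_comm x y -> phase_comm y x.
Proof. exact: phase_eq_sym. Qed.

Lemma phase_comm1 x : phase_comm x 1.
Proof. by rewrite /phase_comm mulr1 mul1r; exact: phase_eqxx. Qed.

Lemma phase_commM x y z : phase_comm x y -> phase_comm x z -> phase_comm x (y * z).
Proof.
rewrite /phase_comm => xy xz; rewrite mulrA.
apply: (phase_eq_trans (phase_eqMr z xy)).
by rewrite -!mulrA; exact: phase_eqMl.
Qed.

Lemma phase_commX x y n : phase_comm x y -> phase_comm x (y ^+ n).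
Proof.
move=> xy; elim: n => [|n IH]; first exact: phase_comm1.
by rewrite exprS; exact: phase_commM.
Qed.

Lemma phase_comm_star x y : unitary_elt y -> phase_comm x y -> phase_comm x (star y).
Proof.
move=> [y1 y2] [a a1 xy]; apply: phase_comm_sym; exists a => //.
by rewrite -[LHS]mulr1 -y2 !mulrA -[_ * x * y]mulrA xy scale_mulr scale_mull !mulrA y1 mul1r.
Qed.

Lemma phase_comm_prod (I : Type) (s : seq I) x (b : I -> A) :
  (forall i, phase_comm x (b i)) -> phase_comm x (\prod_(i <- s) b i).
Proof.
move=> xb; elim: s => [|i s IH]; first by rewrite big_nil; exact: phase_comm1.
by rewrite big_cons; exact: phase_commM.
Qed.

Lemma phase_prodM (I : Type) (s : seq I) (a b : I -> A) :
  (forall i j, phase_comm (a i) (b j)) ->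
  phase_eq ((\prod_(i <- s) a i) * \prod_(i <- s) b i) (\prod_(i <- s) (a i * b i)).
Proof.
move=> ab; elim: s => [|i s IH]; first by rewrite !big_nil mulr1; exact: phase_eqxx.
rewrite !big_cons -!mulrA [X in a i * X]mulrA; apply: phase_eqMl.
apply: phase_eq_trans (phase_eqMl _ IH); rewrite mulrA; apply: phase_eqMr.
by apply: phase_comm_sym; apply: phase_comm_prod => j; exact: phase_comm_sym.
Qed.

End PhaseEq.

Section UnitaryPowers.
Context {R : realType} {A : cstarAlgType R}.
Implicit Types (x y : A) (z w : int).

Lemma unitaryM x y : unitary_elt x -> unitary_elt y -> unitary_elt (x * y).
Proof.
move=> [x1 x2] [y1 y2]; split; rewrite star_mul -mulrA.
  by rewrite [star x * _]mulrA x1 mul1r y1.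
by rewrite [y * _]mulrA y2 mul1r x2.
Qed.

Lemma unitary1 : unitary_elt (1 : A).
Proof. by split; rewrite star_one mulr1. Qed.

Lemma unitary_star x : unitary_elt x -> unitary_elt (star x).
Proof. by move=> [x1 x2]; split; rewrite starK. Qed.

Lemma unitaryX x n : unitary_elt x -> unitary_elt (x ^+ n).
Proof.
move=> ux; elim: n => [|n IH]; first exact: unitary1.
by rewrite exprS; exact: unitaryM.
Qed.

Definition upow x (z : int) : A :=
  match z with Posz n => x ^+ n | Negz n => star x ^+ n.+1 end.

Lemma upow_unitary x z : unitary_elt x -> unitary_elt (upow x z).
Proof. by move=> ux; case: z => n /=; apply: unitaryX => //; exact: unitary_star. Qed.

Lemma upow1D x z : unitary_elt x -> upow x (1 + z) = x * upow x z.
Proof.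
move=> [x1 x2]; case: z => n; first by rewrite -exprS.
rewrite [in RHS]/= exprS mulrA x2 mul1r.
by case: n => [//|n]; rewrite (_ : 1 + Negz n.+1 = Negz n)//; lia.
Qed.

Lemma upowN1D x z : unitary_elt x -> upow x (-1 + z) = star x * upow x z.
Proof.
by move=> ux; rewrite -[z in RHS](addKr (-1)) opprK upow1D// mulrA ux.1 mul1r.
Qed.

Lemma upowD x z w : unitary_elt x -> upow x (z + w) = upow x z * upow x w.
Proof.
move=> ux; elim/int_rec: z => [|n IH|n IH]; first by rewrite add0r mul1r.
  by rewrite intS -addrA !upow1D// IH mulrA.
have -> : - n.+1%:Z = -1 + - n%:Z by lia.
by rewrite -addrA !upowN1D// IH mulrA.
Qed.

Lemma phase_comm_upow x y z : unitary_elt y -> phase_comm x y -> phase_comm x (upow y z).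
Proof.
by move=> uy xy; case: z => n /=; apply: phase_commX => //; exact: phase_comm_star.
Qed.

End UnitaryPowers.


Section Monomials.
Context {R : realType} {A : cstarAlgType R} {d : nat} (u : 'I_d -> A).
Notation Z := {ffun 'I_d -> int}.
Implicit Types (n m : Z) (k : 'I_d) (a b : A).

Definition lbasis k : Z := [ffun i => (i == k)%:R].

Definition monomial n : A := \prod_(i < d) upow (u i) (n i).

Lemma monomial0 : monomial 0 = 1.
Proof. by rewrite /monomial big1// => i _; rewrite ffunE. Qed.

Lemma monomial_basis k : monomial (lbasis k) = u k.
Proof.
rewrite /monomial -[RHS](big_pred1_eq *%R k u) big_mkcond; apply: eq_bigr => i _.
by rewrite ffunE; case: (i == k) => //=; rewrite expr1.
Qed.

Hypothesis u_unitary : forall k, unitary_elt (u k).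
Hypothesis u_comm : forall k l, phase_comm (u k) (u l).

Lemma monomial_unitary n : unitary_elt (monomial n).
Proof.
rewrite /monomial; elim/big_rec : _ => [|i x _ ux]; first exact: unitary1.
by apply: unitaryM => //; exact: upow_unitary.
Qed.

Lemma monomialM n m : phase_eq (monomial n * monomial m) (monomial (n + m)).
Proof.
apply: phase_eq_trans (phase_prodM _ _) _ => [i j|].
  by apply: phase_comm_upow => //; apply: phase_comm_sym; apply: phase_comm_upow.
have -> : monomial (n + m) = \prod_(i < d) (upow (u i) (n i) * upow (u i) (m i)).
  by apply: eq_bigr => i _; rewrite ffunE upowD.
exact: phase_eqxx.
Qed.

Lemma monomial_star n : phase_eq (star (monomial n)) (monomial (- n)).
Proof.
have [a a1 e] := monomialM n (- n).
rewrite subrr monomial0 in e; exists a^-1; first by rewrite normfV a1 invr1.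
have a0 : a != 0 by rewrite -normr_eq0 a1 oner_eq0.
have := congr1 (fun x => star (monomial n) * (a^-1 *: x)) e.
rewrite /= scalerA mulVf// scale1r mulr1 => <-.
by rewrite scale_mulr mulrA (monomial_unitary n).1 mul1r.
Qed.

(** The lattice cube [-N, N]^d, with coordinates shifted by [N]: as a finite type it indexes sums,
    and its cardinality is [(2 * N).+1 ^ d]. *)
Definition box N : finType := {ffun 'I_d -> 'I_(2 * N).+1}.

Definition box_point N (p : box N) : Z := [ffun i => (p i)%:Z - N%:Z].

Lemma box_point_inj N : injective (@box_point N).
Proof.
move=> p q pq; apply/ffunP => i; apply/val_inj/eqP.
have := congr1 (fun f : Z => f i) pq; rewrite !ffunE => /addIr/eqP.
by rewrite eqz_nat.
Qed.

Lemma box_point_le N (p : box N) i : (`|box_point p i| <= N)%N.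
Proof. by rewrite ffunE; have := ltn_ord (p i); lia. Qed.

Lemma box_point_surj N n : (forall i, (`|n i| <= N)%N) -> exists p : box N, box_point p = n.
Proof.
move=> nN; exists [ffun i => inord `|n i + N%:Z|]; apply/ffunP => i.
rewrite !ffunE inordK; have := nN i; move: (n i) => z zN; last by lia.
by rewrite gez0_abs ?addrK //; lia.
Qed.

(** The degree is measured by the largest absolute value of an exponent; this is subadditive under
    products and stable under adjoints. *)
Definition has_degree N a :=
  exists c : box N -> R[i], a = \sum_p c p *: monomial (box_point p).

Lemma has_degree0 N : has_degree N 0.
Proof. by exists (fun=> 0); rewrite big1// => p _; rewrite scale0r. Qed.

Lemma has_degree_lin N (z : R[i]) a b :
  has_degree N a -> has_degree N b -> has_degree N (z *: a + b).
Proof.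
move=> [c ->] [c' ->]; exists (fun p => z * c p + c' p).
by rewrite scaler_sumr -big_split; apply: eq_bigr => p _; rewrite scalerDl scalerA.
Qed.

Lemma has_degreeD N a b : has_degree N a -> has_degree N b -> has_degree N (a + b).
Proof. by move=> ha hb; rewrite -[a]scale1r; exact: has_degree_lin. Qed.

Lemma has_degreeZ N z a : has_degree N a -> has_degree N (z *: a).
Proof. by move=> ha; rewrite -[_ *: _]addr0; apply: has_degree_lin (has_degree0 N). Qed.

Lemma has_degree_sum N (I : Type) (s : seq I) (F : I -> A) :
  (forall i, has_degree N (F i)) -> has_degree N (\sum_(i <- s) F i).
Proof.
move=> FN; elim/big_rec : _ => [|i x _ hx]; first exact: has_degree0.
exact: has_degreeD.
Qed.

Lemma has_degree_monomial N n : (forall i, (`|n i| <= N)%N) -> has_degree N (monomial n).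
Proof.
move=> /box_point_surj[p <-]; exists (fun q => (q == p)%:R).
rewrite (bigD1 p)//= eqxx scale1r big1 ?addr0// => q /negPf ->.
by rewrite scale0r.
Qed.

Lemma has_degree_phase N a b : phase_eq a b -> has_degree N b -> has_degree N a.
Proof. by move=> [z _ ->]; exact: has_degreeZ. Qed.

Lemma has_degreeM N M a b : has_degree N a -> has_degree M b -> has_degree (N + M) (a * b).
Proof.
move=> [c ->] [c' ->]; rewrite big_distrl /=; apply: has_degree_sum => p.
rewrite big_distrr /=; apply: has_degree_sum => q.
rewrite scale_mull scale_mulr; do 2!apply: has_degreeZ.
apply: has_degree_phase (monomialM _ _) _; apply: has_degree_monomial => i.
have := box_point_le p i; have := box_point_le q i.
move: (box_point p) (box_point q) => n m; rewrite ffunE; move: (n i) (m i) => z w; lia.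
Qed.

Lemma has_degree1 : has_degree 0 1.
Proof. by rewrite -monomial0; apply: has_degree_monomial => i; rewrite ffunE. Qed.

Lemma has_degreeX N a e : has_degree N a -> has_degree (e * N) (a ^+ e).
Proof.
move=> ha; elim: e => [|e IH]; first exact: has_degree1.
by rewrite exprS mulSn; exact: has_degreeM.
Qed.

Lemma has_degree_star N a : has_degree N a -> has_degree N (star a).
Proof.
move=> [c ->]; rewrite (big_morph star (@starD _ _) (@star_zero _ _)).
apply: has_degree_sum => p; rewrite starZ; apply: has_degreeZ.
apply: has_degree_phase (monomial_star _) _; apply: has_degree_monomial => i.
by have := box_point_le p i; move: (box_point p) => n; rewrite ffunE abszN.
Qed.

Lemma has_degree_leq N M a : (N <= M)%N -> has_degree N a -> has_degree M a.
Proof.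
move=> NM [c ->]; apply: has_degree_sum => p; apply: has_degreeZ.
by apply: has_degree_monomial => i; exact: leq_trans (box_point_le p i) NM.
Qed.

Definition npolynomial : set A := [set a | exists N, has_degree N a].

Lemma has_degree_gen k : has_degree 1 (u k).
Proof.
by rewrite -monomial_basis; apply: has_degree_monomial => i; rewrite ffunE; case: (i == k).
Qed.

End Monomials.

(** * Faithfulness by polynomial growth *)

(** If [y < x], write [x / y] as [expR t] with [t > 0]. Its [m]-th power is at least
    [(t m)^(d+1) / (d+1)!], which outgrows the factor of order [m^d]. *)
Lemma le_of_exp_le_polynomial (R : realType) (x y : R) (N d : nat) : 0 <= x -> 0 <= y ->
  (forall k, x ^+ (2 ^ k) <= (((2 * (2 ^ k * N)).+1 ^ d)%:R) * y ^+ (2 ^ k)) -> x <= y.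
Proof.
move=> x0 y0 h; rewrite leNgt; apply/negP => yx.
have xp : 0 < x by exact: le_lt_trans yx.
have yp : 0 < y.
  rewrite lt_neqAle y0 andbT eq_sym; apply/eqP => y00.
  by have := h 0%N; rewrite !expn0 !expr1 y00 mulr0 leNgt xp.
pose t := ln (x / y).
have et : expR t = x / y by rewrite lnK// posrE divr_gt0.
have t0 : 0 < t by rewrite ln_gt0// ltr_pdivlMr// mul1r.
pose C : R := ((2 * N).+1 ^ d)%:R.
pose c : R := t ^+ d.+1 / (d.+1)`!%:R.
have c0 : 0 < c by rewrite divr_gt0 ?exprn_gt0// ltr0n fact_gt0.
have bound k : c * (2 ^ k)%:R <= C.
  pose m := (2 ^ k)%N; have m0 : (0 < m)%N by rewrite expn_gt0.
  have mR : 0 < m%:R :> R by rewrite ltr0n.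
  have h1 : (x / y) ^+ m <= C * m%:R ^+ d.
    rewrite expr_div_n ler_pdivrMr ?exprn_gt0//; apply: le_trans (h k) _.
    rewrite ler_wpM2r ?exprn_ge0// /C -natrX -natrM ler_nat -expnMn.
    have [->|dp] := posnP d; first by rewrite !expn0.
    by rewrite leq_exp2r//; rewrite /m in m0 *; nia.
  have h2 : c * m%:R ^+ d.+1 <= (x / y) ^+ m.
    rewrite -et -expRM_natl; apply: le_trans (expR_ge1Dxn d _); last by rewrite mulr_ge0 ?ltW.
    by rewrite exprMn /c mulrAC [t ^+ _ * _]mulrC lerDr.
  have := le_trans h2 h1; rewrite exprS mulrA ler_pM2r// exprn_gt0//.
(* For an integer [k > C / c], the bound [c 2^k <= C] would give [2^k < k]. *)
have := archi_boundP (divr_ge0 (ler0n R _ : 0 <= C) (ltW c0)).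
set k := Num.bound _; rewrite ltr_pdivrMr// mulrC => ck.
have := le_lt_trans (bound k) ck; rewrite ltr_pM2l// ltr_nat.
by rewrite ltnNge ltnW// ltn_expl.
Qed.

(** Cauchy-Schwarz against the constant family, obtained by expanding the square and using
    [2 x_i x_j <= x_i^2 + x_j^2]. *)
Lemma sqr_sum_le (R : realType) (I : finType) (x : I -> R) :
  (\sum_i x i) ^+ 2 <= #|I|%:R * \sum_i x i ^+ 2.
Proof.
rewrite expr2 big_distrl /=.
apply: (@le_trans _ _ (\sum_i \sum_j 2^-1 * (x i ^+ 2 + x j ^+ 2))).
  apply: ler_sum => i _; rewrite big_distrr /=; apply: ler_sum => j _.
  have := sqr_ge0 (x i - x j); rewrite sqrrB => h; lra.
rewrite le_eqVlt; apply/orP; left; apply/eqP.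
set S := \sum_i x i ^+ 2.
transitivity (\sum_i (2^-1 * (#|I|%:R * x i ^+ 2 + S))).
  apply: eq_bigr => i _; rewrite -mulr_sumr big_split /= sumr_const.
  by rewrite -(mulr_natl (x i ^+ 2)).
rewrite -mulr_sumr big_split /= -mulr_sumr sumr_const -/S -(mulr_natl S).
by field.
Qed.

Lemma closure_RP (R : realType) (V : normedModType R[i]) (S : set V) x :
  closure S x <-> forall e : R, 0 < e -> exists2 y, S y & normR (x - y) < e.
Proof.
split=> [cx e e0|h U /nbhs_ballP[eps /= /gt0_Re[e0 ->] sub]].
  have eC : 0 < e%:C :> R[i] by rewrite ltcR.
  have [y [Sy]] := cx _ (nbhsx_ballx x e%:C eC).
  by rewrite -ball_normE /= normRE ltcR; exists y.
have [y Sy xy] := h _ e0; exists y; split=> //; apply: sub.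
by rewrite -ball_normE /= normRE ltcR.
Qed.

Section Density.
Context {R : realType} {A : cstarAlgType R}.
Implicit Types (S : set A) (x y : A).

Lemma closure_cstar_subalgebra S : S 1 ->
  (forall (a : R[i]) x y, S x -> S y -> S (a *: x + y)) ->
  (forall x y, S x -> S y -> S (x * y)) ->
  (forall x, S x -> S (star x)) -> cstar_subalgebra (closure S).
Proof.
move=> S1 Sl SM Ss; split.
- exact: subset_closure.
- move=> a x y /closure_RP cx /closure_RP cy; apply/closure_RP => e e0.
  pose M := complex.Re `|a| + 1.
  have M1 : 0 < M by rewrite ltr_wpDl ?Re_norm_ge0.
  have [x' Sx' xx'] := cx (e / (2 * M)) ltac:(by rewrite divr_gt0// mulr_gt0).
  have [y' Sy' yy'] := cy (e / 2) ltac:(by rewrite divr_gt0).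
  exists (a *: x' + y'); first exact: Sl.
  rewrite opprD addrACA -scalerBr (le_lt_trans (normR_add _ _))// normRZ.
  have : complex.Re `|a| * normR (x - x') <= M * normR (x - x').
    by rewrite ler_wpM2r ?normR_ge0// lerDl.
  rewrite ltr_pdivlMr ?mulr_gt0// in xx'; rewrite -/M; nra.
- move=> x y /closure_RP cx /closure_RP cy; apply/closure_RP => e e0.
  have [r r0 near] := mul_near x y e0.
  have [x' Sx' xx'] := cx r r0; have [y' Sy' yy'] := cy r r0.
  by exists (x' * y'); [exact: SM | exact: near].
- move=> x /closure_RP cx; apply/closure_RP => e e0.
  have [x' Sx' xx'] := cx e e0; exists (star x'); first exact: Ss.
  by rewrite normR_starB.
- exact: closed_closure.
Qed.

Lemma generated_sub d (u : 'I_d -> A) S : cstar_subalgebra S -> (forall k, S (u k)) ->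
  cstar_generated u `<=` S.
Proof. by move=> hS uS; apply: smallest_sub => // _ [k _ <-]. Qed.

Lemma generated_subalgebra d (u : 'I_d -> A) : cstar_subalgebra (cstar_generated u).
Proof.
split.
- by move=> S [[]].
- by move=> a x y hx hy S hS; have [[_ h _ _ _] _] := hS; apply: h; [exact: hx | exact: hy].
- by move=> x y hx hy S hS; have [[_ _ h _ _] _] := hS; apply: h; [exact: hx | exact: hy].
- by move=> x hx S hS; have [[_ _ _ h _] _] := hS; apply: h; exact: hx.
- by apply: closed_bigI => S [[]].
Qed.

Lemma generated_gen d (u : 'I_d -> A) k : cstar_generated u (u k).
Proof. by move=> S [_]; apply; exists k. Qed.

(** Commutation up to phases makes the polynomials a unital star-subalgebra, so their closure is a
    C*-subalgebra containing the generators. *)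
Lemma npolynomial_dense d (u : 'I_d -> A) :
  (forall k, unitary_elt (u k)) -> (forall k l, phase_comm (u k) (u l)) ->
  cstar_generated u `<=` closure (npolynomial u).
Proof.
move=> uU uC; apply: generated_sub; last first.
  by move=> k; apply: subset_closure; exists 1%N; exact: has_degree_gen.
apply: closure_cstar_subalgebra.
- by exists 0%N; exact: has_degree1.
- move=> a x y [N hN] [M hM]; exists (N + M)%N; apply: has_degree_lin.
    by apply: has_degree_leq hN => //; rewrite leq_addr.
  by apply: has_degree_leq hM => //; rewrite leq_addl.
- by move=> x y [N hN] [M hM]; exists (N + M)%N; exact: has_degreeM.
- by move=> x [N hN]; exists N; exact: has_degree_star.
Qed.

End Density.

(* The ring structure of [Defs] is only inferred on abstract C*-algebras. *)
HB.instance Definition _ (R : realType) (H : hilbertType R) :=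
  GRing.Zmodule_isPzRing.Build 'B(H)
    (@cmulA R 'B(H)) (@cmul1l R 'B(H)) (@cmul1r R 'B(H))
    (@cmulDl R 'B(H)) (@cmulDr R 'B(H)).

Section OperatorsAsRing.
Context {R : realType} {H : hilbertType R}.
Implicit Types (f g : 'B(H)) (x y : H).

Lemma opM f g x : (f * g) x = f (g x). Proof. by []. Qed.
Lemma op1 x : (1 : 'B(H)) x = x. Proof. by []. Qed.
Lemma opD f g x : (f + g) x = f x + g x. Proof. by []. Qed.
Lemma opZ (a : R[i]) f x : (a *: f) x = a *: f x. Proof. by []. Qed.

Lemma op_sum (I : Type) (s : seq I) (P : pred I) (F : I -> 'B(H)) x :
  (\sum_(i <- s | P i) F i) x = \sum_(i <- s | P i) F i x.
Proof. exact: (big_morph (fun f : 'B(H) => f x)). Qed.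

Lemma op_starP f x y : inner (f x) y = inner x (star f y).
Proof. exact: adjointP. Qed.

Lemma op_starPr f x y : inner (star f x) y = inner x (f y).
Proof. by rewrite op_starP starK. Qed.

Lemma normR_op_le f x : normR (f x) <= normR f * normR x.
Proof. exact: op_normP. Qed.

Lemma normR_opX_le f n x : normR ((f ^+ n) x) <= normR f ^+ n * normR x.
Proof.
elim: n => [|n IH]; first by rewrite mul1r.
rewrite !exprS opM (le_trans (normR_op_le _ _))// -mulrA.
by rewrite ler_wpM2l ?normR_ge0.
Qed.

Lemma inner_suml (I : Type) (s : seq I) (P : pred I) (F : I -> H) y :
  inner (\sum_(i <- s | P i) F i) y = \sum_(i <- s | P i) inner (F i) y.
Proof.
by apply: (big_morph (fun x => inner x y)) => [a b|]; rewrite ?innerDl ?linear0l.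
Qed.

Lemma inner_sumr (I : Type) (s : seq I) (P : pred I) (F : I -> H) y :
  inner y (\sum_(i <- s | P i) F i) = \sum_(i <- s | P i) inner y (F i).
Proof.
by apply: (big_morph (fun x => inner y x)) => [a b|]; rewrite ?innerDr ?linear0r.
Qed.

End OperatorsAsRing.

Section Faithfulness.
Context {R : realType} {A : cstarAlgType R} {d : nat} (u : 'I_d -> A).
Notation Z := {ffun 'I_d -> int}.
Hypothesis u_unitary : forall k, unitary_elt (u k).
Hypothesis u_comm : forall k l, phase_comm (u k) (u l).
Hypothesis u_gen : cstar_generated u = setT.
Context {K : hilbertType R} (phi : A -> 'B(K)).
Hypothesis phi1 : phi 1 = 1.
Hypothesis phiP : star_morphism_on setT phi.
Context (e : K).
Hypothesis e1 : inner e e = 1.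
Hypothesis orth : forall n : Z, n != 0 -> inner (phi (monomial u n) e) e = 0.

(** The vector state of [e] vanishes on nontrivial monomials, and
    [star (monomial u m) * monomial u n] is one, up to a phase, unless [n = m]. Thus the monomials
    send [e] to an orthonormal family. *)
Lemma inner_monomial (n m : Z) :
  inner (phi (monomial u n) e) (phi (monomial u m) e) = (n == m)%:R.
Proof.
rewrite -op_starPr -opM -(smorph_star phiP) -(smorphM phiP).
have [->|nm] := eqVneq n m.
  by rewrite (monomial_unitary u_unitary m).1 phi1.
have [a _ ->] : phase_eq (star (monomial u m) * monomial u n) (monomial u (- m + n)).
  apply: phase_eq_trans (monomialM u_unitary u_comm _ _).
  exact: phase_eqMr (monomial_star u_unitary u_comm m).
by rewrite (smorphZ phiP) opZ innerZl orth ?mulr0// addrC subr_eq0.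
Qed.

Lemma normR_polynomial_sqr N (c : @box d N -> R[i]) :
  normR (phi (\sum_p c p *: monomial u (box_point p)) e) ^+ 2
  = \sum_p normR (c p : complex_line R) ^+ 2.
Proof.
apply: complexI; rewrite normR_sq (smorph_sum phiP) op_sum inner_suml rmorph_sum.
apply: eq_bigr => p _; rewrite inner_sumr (bigD1 p)//= big1 ?addr0 => [|q qp].
  rewrite (smorphZ phiP) opZ innerZl innerZr inner_monomial eqxx mulr1.
  by rewrite -normCK rmorphXn; congr (_ ^+ 2); exact: normRE.
rewrite !(smorphZ phiP) !opZ innerZl innerZr inner_monomial.
rewrite (inj_eq (@box_point_inj _ _)) eq_sym (negPf qp) !mulr0//.
Qed.

(** Monomials have norm at most 1, so the norm of [a] is at most the l^1-norm of its coefficients.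
    Cauchy-Schwarz over the box compares this with their l^2-norm, which is the norm of
    [phi a e]. *)
Lemma has_degree_normR_le N a : has_degree u N a ->
  normR a ^+ 2 <= ((2 * N).+1 ^ d)%:R * normR (phi a e) ^+ 2.
Proof.
move=> [c ->]; rewrite normR_polynomial_sqr.
have <- : #|@box d N| = ((2 * N).+1 ^ d)%N by rewrite card_ffun !card_ord.
apply: le_trans (sqr_sum_le _).
rewrite lerXn2r ?nnegrE ?normR_ge0//; first by apply: sumr_ge0 => p _; exact: normR_ge0.
rewrite (le_trans (normR_sum _ _ _))//; apply: ler_sum => p _.
rewrite normR_scale ler_piMr ?normR_ge0//.
exact/unitary_normR_le1/monomial_unitary.
Qed.

(* Since [a ^+ m] has [O(m^d)] monomials, the loss in [has_degree_normR_le]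
   disappears after taking [m]-th roots. *)
Lemma npolynomial_normR_le a : npolynomial u a -> normR a <= normR (phi a).
Proof.
(* The C*-identity reduces the claim to [star a * a], for which norms of powers are powers of
   norms. *)
suff sa b N : has_degree u N b -> star b = b -> normR b <= normR (phi b).
  move=> [N hN]; rewrite -(@ler_pXn2r _ 2) ?nnegrE ?normR_ge0// -!normR_starM.
  rewrite -(smorph_star phiP) -(smorphM phiP).
  apply: (sa _ (N + N)%N); last by rewrite star_mul starK.
  by apply: has_degreeM => //; exact: has_degree_star.
move=> hN sb; rewrite -(@ler_pXn2r _ 2) ?nnegrE ?normR_ge0//.
(* The comparison is made between squared norms, because these are what [has_degree_normR_le]
   relates. *)
apply: (le_of_exp_le_polynomial (N := N) (d := d)); rewrite ?sqr_ge0// => k.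
rewrite -!exprM ![(2 * 2 ^ k)%N]mulnC !exprM -selfadjoint_normR_exp//.
have := has_degree_normR_le (has_degreeX u_unitary u_comm (2 ^ k) hN).
move=> /le_trans; apply; rewrite ler_wpM2l//.
rewrite lerXn2r ?nnegrE ?exprn_ge0 ?normR_ge0// (smorphX phi1 phiP).
have := normR_opX_le (phi b) (2 ^ k) e.
have -> : normR e = 1.
  by apply/eqP; rewrite -(@eqrXn2 _ 2) ?normR_ge0// expr1n; apply/eqP/complexI; rewrite normR_sq.
by rewrite mulr1.
Qed.

(** One inequality is contractivity; the other holds on the dense set of polynomials and extends
    because [phi] is continuous. *)
Lemma faithful_isometry a : normR (phi a) = normR a.
Proof.
apply/eqP; rewrite eq_le (smorph_contractive phi1 phiP)/=.
have /closure_RP ca : closure (npolynomial u) a.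
  by apply: npolynomial_dense => //; rewrite u_gen.
apply/ler_addgt0Pr => eps eps0.
have [b Pb ab] := ca (eps / 2) ltac:(by rewrite divr_gt0).
have h1 := normR_add (a - b) b; rewrite subrK in h1.
have h2 := npolynomial_normR_le Pb.
have h3 := normR_add (phi a) (phi (b - a)); rewrite -(smorphD phiP) addrC subrK in h3.
have h4 := smorph_contractive phi1 phiP (b - a); rewrite normR_distC in h4.
rewrite [X in normR (phi a) + normR (phi X)]addrC in h3.
move: h3 h4; rewrite [- a + b]addrC => h3 h4; lra.
Qed.

Lemma faithful_inj : injective phi.
Proof.
move=> a b ab; apply/eqP; rewrite -subr_eq0; apply/eqP/normR_eq0P.
by rewrite -faithful_isometry (smorphB phiP) ab subrr normR_zero.
Qed.

Let v k := phi (u k).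

Lemma faithful_range : range phi = cstar_generated v.
Proof.
have [g1 glin gM gs gcl] := generated_subalgebra v.
apply/seteqP; split.
  move=> _ [a _ <-].
  suff /(_ a) : cstar_generated u `<=` [set a | cstar_generated v (phi a)].
    by rewrite u_gen; apply.
  apply: generated_sub; last by move=> k; exact: (@generated_gen R _ d v k).
  split => /=.
  - by rewrite phi1.
  - by move=> z x y hx hy; rewrite (smorph_lin phiP); exact: glin.
  - by move=> x y hx hy; rewrite (smorphM phiP); exact: gM.
  - by move=> x hx; rewrite (smorph_star phiP); exact: gs.
  - move=> x /closure_RP cx; apply: gcl; apply/closure_RP => eps eps0.
    have [y hy xy] := cx eps eps0; exists (phi y) => //.
    by rewrite -(smorphB phiP) faithful_isometry.
apply: generated_sub; last by move=> k; exists (u k).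
split.
- by exists 1.
- move=> z _ _ [x _ <-] [y _ <-]; exists (z *: x + y) => //.
  by rewrite (smorph_lin phiP).
- by move=> _ _ [x _ <-] [y _ <-]; exists (x * y) => //; rewrite (smorphM phiP).
- by move=> _ [x _ <-]; exists (star x) => //; rewrite (smorph_star phiP).
(* The range is closed: approximants [phi (x n)] of [T] are Cauchy, hence so are the [x n] since
   [phi] is isometric, and their limit is a preimage of [T]. *)
- move=> T /closure_RP cT.
  have /choice[x hx] : forall n : nat, exists x : A, normR (T - phi x) < n.+1%:R^-1.
    move=> n; have [_ [x _ <-] xT] := cT (n.+1%:R^-1) ltac:(by rewrite invr_gt0).
    by exists x.
  have inv0 (r : R) : 0 < r -> exists N, forall n, (N <= n)%N -> n.+1%:R^-1 < r.
    move=> r0; have /cvgrPdist_lt/(_ r r0)[N _ hN] := @cvg_harmonic R.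
    exists N => n Nn; by have := hN n Nn; rewrite sub0r normrN ger0_norm ?harmonic_ge0.
  have [l xl] : exists l : A, x @ \oo --> l.
    apply/cvg_ex; apply: cauchy_cvg; apply/cauchy_R => eps eps0.
    have [N hN] := inv0 (eps / 2) ltac:(by rewrite divr_gt0).
    exists (x N); exists N => // n /= Nn.
    rewrite -faithful_isometry (smorphB phiP).
    apply: (le_lt_trans (normR_dist_add T _ _)).
    rewrite [eps]splitr; apply: ltrD; last exact: lt_trans (hx n) (hN n Nn).
    by rewrite normR_distC; exact: lt_trans (hx N) (hN N (leqnn N)).
  exists l => //; apply: (@cvg_unique 'B(K) _ ((fun n => phi (x n)) @ \oo)) => //.
  + exact: (smorph_cvg phi1 phiP xl).
  + apply/cvg_RP => r r0; have [N hN] := inv0 r r0.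
    by exists N => // n /= Nn; exact: lt_trans (hx n) (hN n Nn).
Qed.

Lemma faithful_tuple_equiv : tuple_equiv v u.
Proof.
have hr T : cstar_generated v T -> exists a, phi a = T.
  by rewrite -faithful_range => -[a _ <-]; exists a.
(* The inverse of [phi] on its range. Elsewhere it takes the default value 0, which is harmless
   because [tuple_equiv] only considers [psi] on C*(v). *)
pose psi (T : 'B(K)) : A := xget 0 [set a | phi a = T].
have psiK a : psi (phi a) = a.
  by apply: faithful_inj; exact: (@xgetPex _ 0 [set b | phi b = phi a] (ex_intro _ a erefl)).
have phiK T : cstar_generated v T -> phi (psi T) = T.
  by move=> /hr[a <-]; rewrite psiK.
have gphi a : cstar_generated v (phi a) by rewrite -faithful_range; exists a.
exists psi; split; last by move=> k; exact: psiK.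
  split.
  - by move=> T _; rewrite u_gen.
  - move=> T S; rewrite !inE => hT hS TS.
    by rewrite -(phiK T)// -(phiK S)// TS.
  - by move=> a _; exists (phi a).
split.
- move=> z T S hT hS; apply: faithful_inj; rewrite (smorph_lin phiP) !phiK//.
  by have [_ h _ _ _] := generated_subalgebra v; exact: h.
- move=> T S hT hS; apply: faithful_inj; rewrite (smorphM phiP) !phiK//.
  by have [_ _ h _ _] := generated_subalgebra v; exact: h.
- move=> T hT; apply: faithful_inj; rewrite (smorph_star phiP) !phiK//.
  by have [_ _ _ h _] := generated_subalgebra v; exact: h.
Qed.

End Faithfulness.

(** * Operators on spaces of square summable families *)

(** A contraction with contractive inverse is isometric, so expanding the squared norm of
    [x - star f (f x)] gives at most [|x|^2 - 2 |x|^2 + |x|^2 = 0]. This identifies adjoints of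
    shifts and diagonal operators from their inverses. *)
Lemma contraction_inverse_star (R : realType) (H : hilbertType R) (f g : 'B(H)) :
  normR f <= 1 -> normR g <= 1 -> g * f = 1 -> f * g = 1 -> star f = g.
Proof.
move=> f1 g1 gf fg.
have le (h : 'B(H)) x : normR h <= 1 -> normR (h x) <= normR x.
  by move=> h1; rewrite (le_trans (normR_op_le _ _))// ler_piMl ?normR_ge0.
have sf1 : normR (star f) <= 1 by rewrite normR_star.
have isof x : normR (f x) = normR x.
  apply/eqP; rewrite eq_le le//=.
  by have := le g (f x) g1; rewrite -opM gf op1.
suff sff : star f * f = 1 by rewrite -[LHS]mulr1 -fg mulrA sff mul1r.
apply: bounded_opE => x; rewrite opM op1; apply/esym/eqP.
rewrite -subr_eq0 -normR_eq0 -sqrf_eq0 eq_le sqr_ge0 andbT.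
have e1 : inner x (star f (f x)) = (normR x ^+ 2)%:C by rewrite -op_starP -normR_sq isof.
have e2 : inner (star f (f x)) x = (normR x ^+ 2)%:C by rewrite op_starPr -normR_sq isof.
rewrite -lecR normR_sq !(innerDl, innerDr, innerNl, innerNr) e1 e2 -!normR_sq.
have h : normR (star f (f x)) ^+ 2 <= normR x ^+ 2.
  by rewrite lerXn2r ?nnegrE ?normR_ge0// (le_trans (le _ _ sf1))// isof.
by rewrite subrr add0r opprK addrC subr_le0 lecR.
Qed.

Section Ell2Vectors.
Context {R : realType} {I : choiceType} {K : hilbertType R}.
Implicit Types (f g : ell2 I K).
Notation C := (complex_line R).

Lemma inner_ell2_scale (K' : hilbertType R) f g (f' g' : ell2 I K') (c : R[i]) :
  (forall s, inner (f s) (g s) = c * inner (f' s) (g' s)) ->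
  inner f g = c * inner f' g'.
Proof.
move=> h; apply: inner_ell2.
under eq_fun do rewrite (eq_bigr _ (fun i _ => h i)) -mulr_sumr.
apply: (@cvg_cmul R _ fset_filter _ c); exact: inner_ell2_cvg.
Qed.

Lemma inner_ell2_finite (F0 : {fset I}) f g (l : R[i]) :
  (forall F : {fset I}, (F0 `<=` F)%fset -> \sum_(i <- F) inner (f i) (g i) = l) ->
  inner f g = l.
Proof.
move=> h; apply: inner_ell2; apply/cvg_RP => e e0.
by exists F0 => // F /= /h ->; rewrite subrr normR_zero.
Qed.

Lemma square_summable_single (i : I) (h : K) :
  (fun s : I => if s == i then h else 0) \in square_summable.
Proof.
apply/square_summableP; exists (normR h ^+ 2) => F; rewrite /sqsum.
have [iF|iF] := boolP (i \in F).
  rewrite (big_fsetD1 i)//= eqxx big1_fset ?addr0// => j.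
  by rewrite !inE => /andP[/negPf -> _] _; rewrite normR_zero expr0n.
rewrite big1_fset ?sqr_ge0// => j jF _.
case: eqP => [ji|_]; last by rewrite normR_zero expr0n.
by rewrite -ji jF in iF.
Qed.

Definition ell2_single i h : ell2 I K := Ell2 (square_summable_single i h).

Lemma inner_single i h g : inner (ell2_single i h) g = inner h (g i).
Proof.
apply: (inner_ell2_finite (F0 := [fset i]%fset)) => F iF.
have {}iF : i \in F by rewrite -fsub1set.
rewrite (big_fsetD1 i)//= eqxx big1_fset ?addr0// => j.
by rewrite !inE => /andP[/negPf -> _] _; rewrite linear0l.
Qed.

End Ell2Vectors.

Lemma inner_ell2_fin (R : realType) (T : finType) (K : hilbertType R) (f g : ell2 T K) :
  inner f g = \sum_t inner (f t) (g t).
Proof.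
apply: (inner_ell2_finite (F0 := [fset t in T]%fset)) => F FT.
rewrite [LHS]big_uniq ?fset_uniq//=; apply: eq_bigl => t.
by apply: (fsubsetP FT); rewrite inE.
Qed.

Section Tensor.
Context {R : realType} {I : choiceType} {K : hilbertType R}.
Notation C := (complex_line R).
Implicit Types (xi eta : ell2 I C) (h : K).

Lemma square_summable_tensor xi h :
  (fun s : I => (xi s : R[i]) *: h) \in square_summable.
Proof.
apply/square_summableP; exists (sqnorm xi * normR h ^+ 2) => F.
apply: le_trans (ler_wpM2r (sqr_ge0 _) (sqsum_le xi F)).
rewrite /sqsum mulr_suml le_eqVlt; apply/orP; left; apply/eqP.
by apply: eq_bigr => s _; rewrite normR_scale exprMn.
Qed.

(** The elementary tensor, under the identification of l^2(I) tensor [K] with the [K]-valued square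
    summable families. *)
Definition tensor xi h : ell2 I K := Ell2 (square_summable_tensor xi h).

Lemma inner_tensor xi eta h h' :
  inner (tensor xi h) (tensor eta h') = inner xi eta * inner h h'.
Proof.
rewrite mulrC; apply: inner_ell2_scale => s /=.
by rewrite innerZl innerZr mulrA mulrC.
Qed.

End Tensor.

Section Ell2Map.
Context {R : realType} {I : choiceType} {H K : hilbertType R}.
Context (J : H -> K) (Jiso : forall x, normR (J x) = normR x).

Lemma square_summable_map (f : ell2 I H) : (fun s : I => J (f s)) \in square_summable.
Proof.
apply/square_summableP; exists (sqnorm f) => F; apply: le_trans (sqsum_le f F).
by rewrite /sqsum; under eq_bigr do rewrite Jiso.
Qed.

Definition ell2_map (f : ell2 I H) : ell2 I K := Ell2 (square_summable_map f).

Lemma normR_ell2_map f : normR (ell2_map f) = normR f.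
Proof.
suff : ell2_norm (ell2_map f) = ell2_norm f by [].
rewrite /ell2_norm /sqnorm (_ : sqsum (ell2_map f) = sqsum f)//.
by apply/funext => F; rewrite /sqsum; apply: eq_bigr => i _; rewrite /= Jiso.
Qed.

End Ell2Map.

Section MonomialOperators.
Context {R : realType} {I : choiceType} {K : hilbertType R}.
Context (p : I -> I) (w : I -> 'B(K)) (p_inj : injective p)
  (w_bound : exists M : R, forall s, normR (w s) <= M).

Lemma sqsum_monop (f : ell2 I K) (M : R) F : 0 <= M ->
  (forall s, normR (w s) <= M) ->
  sqsum (fun s => w s (f (p s))) F <= M ^+ 2 * sqnorm f.
Proof.
move=> M0 wM; apply: le_trans (ler_wpM2l (sqr_ge0 M) (sqsum_le f [fset p s | s in F]%fset)).
rewrite /sqsum big_imfset//=; last by move=> x y _ _; exact: p_inj.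
rewrite mulr_sumr; apply: ler_sum => s _; rewrite -exprMn.
rewrite lerXn2r ?nnegrE ?mulr_ge0 ?normR_ge0// (le_trans (normR_op_le _ _))//.
by rewrite ler_wpM2r ?normR_ge0.
Qed.

Lemma square_summable_monop (f : ell2 I K) : (fun s => w s (f (p s))) \in square_summable.
Proof.
have [M wM] := w_bound; apply/square_summableP.
exists (Num.max M 0 ^+ 2 * sqnorm f) => F; apply: sqsum_monop => [|s].
  by rewrite le_max lexx orbT.
by rewrite le_max wM.
Qed.

(** A weighted composition operator: translations for [p] give [lam], and the identity gives
    [diag_op]. *)
Definition monop_fun (f : ell2 I K) : ell2 I K := Ell2 (square_summable_monop f).

Lemma monop_fun_le M f : 0 <= M -> (forall s, normR (w s) <= M) ->
  normR (monop_fun f) <= M * normR f.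
Proof.
move=> M0 wM; rewrite !normR_ell2; apply: ell2_norm_le => [|F].
  by rewrite mulr_ge0 ?ell2_norm_ge0.
by rewrite exprMn ell2_norm_sqr; exact: sqsum_monop.
Qed.

Lemma monop_bounded : monop_fun \in bounded_linear.
Proof.
have [M wM] := w_bound; apply: (bounded_opI (M := Num.max M 0)) => [a f g|f].
  by apply: ell2E => s /=; rewrite linearP.
by apply: monop_fun_le => [|s]; rewrite le_max ?wM ?lexx ?orbT.
Qed.

Definition monop : 'B(ell2 I K) := BoundedOp monop_bounded.

Lemma normR_monop_le M : 0 <= M -> (forall s, normR (w s) <= M) -> normR monop <= M.
Proof. by move=> M0 wM; apply: op_norm_le => // f; exact: monop_fun_le. Qed.

End MonomialOperators.

(** * The twisted regular representation *)

Section Expi.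
Context {R : realType}.

Lemma expiD (a b : R) : expi (a + b) = expi a * expi b.
Proof.
by apply/eqP; rewrite eq_complex /= cosD sinD eqxx /=; apply/eqP; ring.
Qed.

Lemma expi0 : expi (0 : R) = 1.
Proof. by apply/eqP; rewrite eq_complex /= cos0 sin0 !eqxx. Qed.

Lemma norm_expi (a : R) : `|expi a| = 1 :> R[i].
Proof. by rewrite normc_def /= cos2Dsin2 sqrtr1. Qed.

End Expi.

Section LatticeOperators.
Context {R : realType} {d : nat} (Theta : 'M[R]_d).
Notation Z := {ffun 'I_d -> int}.
Implicit Types (x y n : Z).

Definition bform x y : R := \sum_j \sum_k Theta j k * (x j)%:~R * (y k)%:~R.

Lemma bformDl x y n : bform (x + y) n = bform x n + bform y n.
Proof.
rewrite -big_split; apply: eq_bigr => j _; rewrite -big_split; apply: eq_bigr => k _.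
by rewrite ffunE intrD /=; ring.
Qed.

Lemma bformNl x n : bform (- x) n = - bform x n.
Proof.
rewrite -sumrN; apply: eq_bigr => j _; rewrite -sumrN; apply: eq_bigr => k _.
by rewrite ffunE mulrNz /=; ring.
Qed.

Lemma bform_basis k l : bform (lbasis k) (lbasis l) = Theta k l.
Proof.
rewrite /bform (bigD1 k)//= (bigD1 l)//= !ffunE !eqxx !mulr1.
rewrite !big1 ?addr0// => [j jk|j jl].
  by rewrite big1// => i _; rewrite ffunE (negPf jk) mulr0 mul0r.
by rewrite ffunE (negPf jl) mulr0.
Qed.

Hypothesis antisym : Theta^T = - Theta.

Lemma bformC x y : bform y x = - bform x y.
Proof.
rewrite /bform exchange_big /= -sumrN; apply: eq_bigr => j _.
rewrite -sumrN; apply: eq_bigr => k _.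
by have := congr1 (fun M : 'M[R]_d => M j k) antisym; rewrite !mxE => ->; ring.
Qed.

Lemma bformxx x : bform x x = 0.
Proof. by have := bformC x x; lra. Qed.

Lemma bformNr x y : bform x (- y) = - bform x y.
Proof. by rewrite bformC bformNl [bform y x]bformC opprK. Qed.

Context {K : hilbertType R}.
Implicit Types (X Y : 'B(K)).

Definition lam_weight x X (s : Z) : 'B(K) := expi (bform s x / 2) *: X.

Lemma normR_lam_weight x X s : normR (lam_weight x X s) = normR X.
Proof. by rewrite normR_scale1// norm_expi. Qed.

Lemma lam_bound x X : exists M : R, forall s, normR (lam_weight x X s) <= M.
Proof. by exists (normR X) => s; rewrite normR_lam_weight. Qed.

(* [lam x X] is the tensor product with [X] of the unitary
   [delta_n -> expi (bform n x / 2) delta_(n + x)] of the twisted left regular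
   representation of Z^d. *)
Definition lam x X : 'B(ell2 Z K) :=
  @monop R Z K (fun s => s - x) (lam_weight x X) (@subIr _ x) (lam_bound x X).

Lemma lamE x X f s : lam x X f s = expi (bform s x / 2) *: X (f (s - x)).
Proof. by []. Qed.

Lemma normR_lam x X : normR (lam x X) <= normR X.
Proof.
by apply: normR_monop_le => [|s]; [exact: normR_ge0|rewrite normR_lam_weight].
Qed.

(** By antisymmetry the two orders of composition contribute the half-phases [bform x y / 2] and
    [- bform x y / 2], whose difference is the full form. The phase [b] of the second tensor factor
    is multiplied in, so suitable factors can cancel. *)
Lemma lam_comm x y X Y (b : R[i]) : Y * X = b *: (X * Y) ->
  lam y Y * lam x X = (expi (bform x y) * b) *: (lam x X * lam y Y).
Proof.
move=> YX; apply: bounded_opE => f; apply: ell2E => s.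
rewrite opZ ell2ZE !opM !lamE !linearZ /= !scalerA -!opM YX opZ !scalerA.
rewrite [s - y - x]addrAC; congr (_ *: _).
have key : expi (bform s y / 2) * expi (bform (s - y) x / 2)
    = expi (bform x y) * (expi (bform s x / 2) * expi (bform (s - x) y / 2)).
  by rewrite -!expiD; congr expi; rewrite !bformDl !bformNl (bformC x y); field.
by rewrite [LHS](congr1 (fun z => z * b) (mulrC _ _)) key; ring.
Qed.

Lemma lam_inv x X Y : Y * X = 1 -> lam (- x) Y * lam x X = 1.
Proof.
move=> YX; apply: bounded_opE => f; apply: ell2E => s.
rewrite op1 opM !lamE linearZ /= scalerA -opM YX op1 opprK addrK -expiD.
by rewrite bformNr bformDl bformxx addr0 mulNr addNr expi0 scale1r.
Qed.

Lemma lam_star x X : unitary_elt X -> star (lam x X) = lam (- x) (star X).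
Proof.
move=> uX; apply: contraction_inverse_star.
- by rewrite (le_trans (normR_lam _ _))// unitary_normR_le1.
- by rewrite (le_trans (normR_lam _ _))// normR_star unitary_normR_le1.
- by apply: lam_inv; exact: uX.1.
- by rewrite -{1}[x]opprK; apply: lam_inv; exact: uX.2.
Qed.

Lemma lam_unitary x X : unitary_elt X -> unitary_elt (lam x X).
Proof.
move=> uX; split; rewrite lam_star//.
  by apply: lam_inv; exact: uX.1.
by rewrite -{1}[x]opprK; apply: lam_inv; exact: uX.2.
Qed.

End LatticeOperators.

Section DiagonalOperators.
Context {R : realType} {T : finType} {K : hilbertType R}.
Implicit Types (W : T -> 'B(K)).

Lemma diag_bound W : exists M : R, forall t, normR (W t) <= M.
Proof.
exists (\sum_t normR (W t)) => t; rewrite (bigD1 t)//= lerDl.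
by apply: sumr_ge0 => s _; exact: normR_ge0.
Qed.

(** The direct sum of the operators [W t] on the direct sum of copies of [K] indexed by [T]. *)
Definition diag_op W : 'B(ell2 T K) := monop (@inj_id T) (diag_bound W).

Lemma diagE W f t : diag_op W f t = W t (f t). Proof. by []. Qed.

Lemma diag_comm W W' (b : R[i]) : (forall t, W' t * W t = b *: (W t * W' t)) ->
  diag_op W' * diag_op W = b *: (diag_op W * diag_op W').
Proof.
move=> h; apply: bounded_opE => f; apply: ell2E => t.
by rewrite opZ ell2ZE !opM !diagE -!opM h.
Qed.

Lemma diag_star W : (forall t, unitary_elt (W t)) ->
  star (diag_op W) = diag_op (fun t => star (W t)).
Proof.
move=> uW; apply: contraction_inverse_star.
- by apply: normR_monop_le => // t; exact: unitary_normR_le1.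
- by apply: normR_monop_le => // t; rewrite normR_star; exact: unitary_normR_le1.
- apply: bounded_opE => f; apply: ell2E => t.
  by rewrite op1 opM !diagE -opM (uW t).1.
- apply: bounded_opE => f; apply: ell2E => t.
  by rewrite op1 opM !diagE -opM (uW t).2.
Qed.

Lemma diag_unitary W : (forall t, unitary_elt (W t)) -> unitary_elt (diag_op W).
Proof.
move=> uW; split; rewrite diag_star//; apply: bounded_opE => f; apply: ell2E => t.
  by rewrite op1 opM !diagE -opM (uW t).1.
by rewrite op1 opM !diagE -opM (uW t).2.
Qed.

End DiagonalOperators.

(** * Graded representations and their faithfulness *)

Section GradedTuples.
Context {R : realType} {d : nat}.
Notation Z := {ffun 'I_d -> int}.
Context {K : hilbertType R} (v : 'I_d -> 'B(K)) (E : Z -> set K).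
Hypothesis E_gen : forall k x f, E x f -> E (x + lbasis k) (v k f).
Hypothesis E_star : forall k x f, E x f -> E (x - lbasis k) (star (v k) f).

Lemma graded_upow k z x f : E x f -> E (x + lbasis k *~ z) (upow (v k) z f).
Proof.
have gX n : E x f -> E (x + lbasis k *+ n) ((v k ^+ n) f).
  by elim: n => [|n IH] // Ef; rewrite ?addr0// exprS mulrSr addrA; apply/E_gen/IH.
have gN n : E x f -> E (x - lbasis k *+ n) ((star (v k) ^+ n) f).
  elim: n => [|n IH] // Ef; first by rewrite subr0.
  by rewrite exprS mulrSr opprD addrA; apply/E_star/IH.
by case: z => n; [exact: gX | rewrite NegzE mulrNz; exact: gN].
Qed.

Lemma sum_lbasis (n : Z) : \sum_k lbasis k *~ n k = n.
Proof.
apply/ffunP => i; rewrite sum_ffunE (bigD1 i)//= big1 ?addr0 => [|j ji].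
  by rewrite ffunMzE ffunE eqxx intz.
by rewrite ffunMzE ffunE eq_sym (negPf ji) mul0rz.
Qed.

Lemma graded_monomial n x f : E x f -> E (x + n) (monomial v n f).
Proof.
move=> Ef; rewrite -[in E _](sum_lbasis n) /monomial addrC.
elim: (index_enum _) => [|k s IH]; first by rewrite !big_nil add0r op1.
rewrite !big_cons opM -addrA addrC; exact: graded_upow.
Qed.

End GradedTuples.

Lemma relations_phase_comm (R : realType) (A : cstarAlgType R) d (Theta : 'M[R]_d)
  (u : 'I_d -> A) : noncommutative_torus_relations Theta u ->
  forall k l, phase_comm (u k) (u l).
Proof.
by move=> [_ uC] k l; exists (expi (Theta l k)); [exact: norm_expi | exact: uC].
Qed.

Lemma smorph_upow (R : realType) (A B : cstarAlgType R) (phi : A -> B) x z :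
  phi 1 = 1 -> star_morphism_on setT phi -> phi (upow x z) = upow (phi x) z.
Proof.
by move=> phi1 phiP; case: z => n /=; rewrite (smorphX phi1 phiP) ?(smorph_star phiP).
Qed.

(** The monomial of exponent [n] moves [e] from degree 0 to degree [n], and different degrees are
    orthogonal to degree 0: this is the orthogonality from which polynomial growth gives
    faithfulness. *)
Lemma graded_faithful (R : realType) (A : cstarAlgType R) d (Theta : 'M[R]_d)
    (u : 'I_d -> A) (K : hilbertType R) (v : 'I_d -> 'B(K))
    (E : {ffun 'I_d -> int} -> set K) (e : K) :
  noncommutative_torus Theta u -> noncommutative_torus_relations Theta v ->
  (forall k x f, E x f -> E (x + lbasis k) (v k f)) ->
  (forall k x f, E x f -> E (x - lbasis k) (star (v k) f)) ->
  (forall x f g, x != 0 -> E x f -> E 0 g -> inner f g = 0) ->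
  E 0 e -> inner e e = 1 ->
  exists phi : A -> 'B(K), [/\ phi 1 = 1, star_morphism_on setT phi,
    forall k, phi (u k) = v k, forall a, normR (phi a) = normR a & tuple_equiv v u].
Proof.
move=> [ur ug uu] vr Eg Es Eo Ee e1; have [phi [phi1 phiP phiu]] := uu _ _ vr.
have orth (n : {ffun 'I_d -> int}) : n != 0 -> inner (phi (monomial u n) e) e = 0.
  move=> n0; apply: (Eo n) => //.
  have -> : phi (monomial u n) = monomial v n.
    rewrite /monomial (smorph_prod phi1 phiP); apply: eq_bigr => i _.
    by rewrite smorph_upow// phiu.
  by have := graded_monomial Eg Es n Ee; rewrite add0r.
have [uU _] := ur; have uC := relations_phase_comm ur.
exists phi; split => //.
  exact: (faithful_isometry uU uC ug phi1 phiP e1 orth).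
have <- : (fun k => phi (u k)) = v by apply/funext.
exact: (faithful_tuple_equiv uU uC ug phi1 phiP e1 orth).
Qed.

Lemma inner_ell2_eq0 (R : realType) (I : choiceType) (K : hilbertType R) (f g : ell2 I K) :
  (forall s, inner (f s) (g s) = 0) -> inner f g = 0.
Proof. by move=> h; apply: (inner_ell2_finite (F0 := fset0)) => F _; rewrite big1. Qed.

Section LatticeTuples.
Context {R : realType} {d : nat} (Theta : 'M[R]_d) (antisym : Theta^T = - Theta).
Notation Z := {ffun 'I_d -> int}.
Context {K : hilbertType R}.

Lemma lam_relations (Theta' : 'M[R]_d) (x : 'I_d -> Z) (X : 'I_d -> 'B(K)) (t : 'I_d -> 'I_d -> R) :
  (forall k, unitary_elt (X k)) ->
  (forall k l, X l * X k = expi (t k l) *: (X k * X l)) ->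
  (forall k l, bform Theta (x k) (x l) + t k l = Theta' k l) ->
  noncommutative_torus_relations Theta' (fun k => lam Theta (x k) (X k)).
Proof.
move=> uX cX tE; split=> [k|k l]; first exact: lam_unitary.
by rewrite -tE expiD; apply: lam_comm => //; exact: cX.
Qed.

Definition homogeneous (n : Z) : set (ell2 Z K) := [set f | forall s, s != n -> f s = 0].

Lemma lam_homogeneous x X n f : homogeneous n f -> homogeneous (n + x) (lam Theta x X f).
Proof.
move=> hf s sn; rewrite lamE hf ?linear0 ?scaler0//.
by apply: contra sn => /eqP <-; rewrite subrK.
Qed.

Lemma homogeneous_orth n f g : n != 0 -> homogeneous n f -> homogeneous 0 g -> inner f g = 0.
Proof.
move=> n0 hf hg; apply: inner_ell2_eq0 => s.
have [->|sn] := eqVneq s n; first by rewrite hg// linear0r.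
by rewrite hf// linear0l.
Qed.

Lemma homogeneous_single n h : homogeneous n (ell2_single n h).
Proof. by move=> s /negPf sn /=; rewrite sn. Qed.

(** The lattice factor alone provides the grading, whatever the unitaries [X k] are, while the
    commutation phases of the two factors add up to [Theta']. *)
Lemma lam_faithful (A : cstarAlgType R) (Theta' : 'M[R]_d) (u : 'I_d -> A)
    (X : 'I_d -> 'B(K)) (t : 'I_d -> 'I_d -> R) (h : K) :
  noncommutative_torus Theta' u ->
  (forall k, unitary_elt (X k)) ->
  (forall k l, X l * X k = expi (t k l) *: (X k * X l)) ->
  (forall k l, Theta k l + t k l = Theta' k l) ->
  inner h h = 1 ->
  let v k := lam Theta (lbasis k) (X k) in
  exists phi : A -> 'B(ell2 Z K), [/\ phi 1 = 1, star_morphism_on setT phi,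
    forall k, phi (u k) = v k, forall a, normR (phi a) = normR a & tuple_equiv v u].
Proof.
move=> uu uX cX tE h1 v.
apply: (graded_faithful (E := homogeneous) (e := ell2_single 0 h) uu).
- by apply: lam_relations uX cX _ => k l; rewrite bform_basis.
- by move=> k x f; exact: lam_homogeneous.
- by move=> k x f; rewrite /v lam_star//; exact: lam_homogeneous.
- exact: homogeneous_orth.
- exact: homogeneous_single.
- by rewrite inner_single /= eqxx.
Qed.

End LatticeTuples.

(** The relations hold after applying the isomorphism [psi] and are pulled back by its injectivity
    on C*(w). *)
Lemma tuple_equiv_relations (R : realType) (A B : cstarAlgType R) d (Theta : 'M[R]_d)
    (w : 'I_d -> B) (u : 'I_d -> A) : cstar_generated u = setT -> tuple_equiv w u ->
  noncommutative_torus_relations Theta u -> noncommutative_torus_relations Theta w.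
Proof.
move=> ug [psi [[_ psi_inj psi_surj] [plin pM ps] psiw]] [uU uC].
have [g1 glin gM gs _] := generated_subalgebra w.
have gw k : cstar_generated w (w k) by exact: (@generated_gen R B d w k).
(* [star_morphism_on] does not include unitality; it follows from surjectivity, since a preimage [x]
   of 1 gives [psi 1 = psi 1 * psi x = psi x]. *)
have psi1 : psi 1 = 1.
  have [x gx px] : exists2 x, cstar_generated w x & psi x = 1.
    by apply: psi_surj; rewrite ug.
  by rewrite -[LHS]mulr1 -px -pM// mul1r.
have inj x y : cstar_generated w x -> cstar_generated w y -> psi x = psi y -> x = y.
  by move=> gx gy; apply: psi_inj; rewrite inE.
have g0 : cstar_generated w 0.
  by rewrite -(addNr 1) -scaleN1r; exact: glin.
have psi0 : psi 0 = 0.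
  have e := plin 1 0 0 g0 g0; rewrite !scale1r !addr0 in e.
  by rewrite -[LHS](addrK (psi 0)) -e subrr.
have psiZ a x : cstar_generated w x -> psi (a *: x) = a *: psi x.
  by move=> gx; rewrite -[a *: x]addr0 plin// psi0 addr0.
have gZ a x : cstar_generated w x -> cstar_generated w (a *: x).
  by move=> gx; rewrite -[a *: x]addr0; exact: glin.
split=> [k|k l].
  have [gk gsk] := (gw k, gs _ (gw k)).
  split; apply: inj => //; [exact: gM | | exact: gM | ].
    by rewrite pM// ps// psiw (uU k).1 psi1.
  by rewrite pM// ps// psiw (uU k).2 psi1.
have [gk gl] := (gw k, gw l).
apply: inj; [exact: gM | by apply: gZ; exact: gM|].
by rewrite (psiZ _ _ (gM _ _ gk gl)) (pM _ _ gl gk) (pM _ _ gk gl) !psiw uC.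
Qed.

(** * The norm of a selfadjoint operator as its numerical radius *)

Section NumericalRadius.
Context {R : realType} {H : hilbertType R}.

Lemma ReD (x y : R[i]) : complex.Re (x + y) = complex.Re x + complex.Re y.
Proof. by case: x y => [? ?] [? ?]. Qed.

Lemma ReN (x : R[i]) : complex.Re (- x) = - complex.Re x.
Proof. by case: x. Qed.

Lemma Re_conj (x : R[i]) : complex.Re (Num.conj x) = complex.Re x.
Proof. by case: x. Qed.

(** The real part of [inner (S x) y] is a quarter of the difference of the quadratic form at [x + y]
    and [x - y]; the hypothesis and the parallelogram law bound it. *)
Lemma numerical_radius (S : 'B(H)) (M : R) : star S = S -> 0 <= M ->
  (forall x, `|complex.Re (inner (S x) x)| <= M * normR x ^+ 2) -> normR S <= M.
Proof.
move=> sS M0 hM; apply: op_norm_le => // x.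
have [x0|x0] := eqVneq (normR (S x)) 0; first by rewrite x0 mulr_ge0 ?normR_ge0.
have Sp : 0 < normR (S x) by rewrite lt_neqAle eq_sym x0 normR_ge0.
have xp : 0 < normR x.
  rewrite lt_neqAle normR_ge0 andbT eq_sym normR_eq0; apply: contra x0 => /eqP ->.
  by rewrite linear0 normR_zero.
(* This makes [y] a multiple of [S x] with the norm of [x], so the parallelogram law sums to
   [4 |x|^2]. *)
pose t := normR x / normR (S x).
pose y := t%:C *: S x.
have yn : normR y = normR x.
  by rewrite normR_scaleR ger0_norm ?divr_ge0 ?normR_ge0// divfK.
have polar : complex.Re (inner (S (x + y)) (x + y)) - complex.Re (inner (S (x - y)) (x - y))
    = 4 * complex.Re (inner (S x) y).
  have yx : inner (S y) x = Num.conj (inner (S x) y) by rewrite op_starP sS -innerC.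
  have SD a b : S (a + b) = S a + S b by exact: linearD.
  have SN a : S (- a) = - S a by exact: linearN.
  rewrite !SD SN !(innerDl, innerDr, innerNl, innerNr) yx !(ReD, ReN) Re_conj.
  ring.
have xy : complex.Re (inner (S x) y) = normR x * normR (S x).
  rewrite innerZr conj_realC -normR_sq -rmorphM /= /t expr2 mulrA divfK//.
have par := parallelogramR x y.
have h1 := hM (x + y); have h2 := hM (x - y).
have l1 := ler_norm (complex.Re (inner (S (x + y)) (x + y))).
have l2 := lerNnormlW (lexx `|complex.Re (inner (S (x - y)) (x - y))|).
rewrite -(ler_pM2l xp).
rewrite xy in polar; rewrite yn in par.
nra.
Qed.

Lemma numerical_radius_ex (S : 'B(H)) (M : R) : star S = S -> 0 <= M -> M < normR S ->
  exists x, inner x x = 1 /\ M < `|complex.Re (inner (S x) x)|.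
Proof.
move=> sS M0 MS; apply: contrapT => h.
move: MS; rewrite ltNge => /negP; apply; apply: numerical_radius => // x.
have [x0|x0] := eqVneq (normR x) 0.
  have -> : x = 0 by exact: normR_eq0P.
  have -> : S 0 = 0 by exact: linear0.
  by rewrite linear0l normR_zero expr0n mulr0 /= normr0.
have xp : 0 < normR x by rewrite lt_neqAle eq_sym x0 normR_ge0.
rewrite leNgt; apply/negP => lt; apply: h.
exists ((normR x)^-1%:C *: x).
have e1 : (normR x)^-1%:C * Num.conj ((normR x)^-1)%:C = ((normR x ^+ 2)^-1)%:C :> R[i].
  by rewrite conj_realC -rmorphM expr2 invfM.
split.
  by rewrite innerZl innerZr mulrA e1 -normR_sq -rmorphM mulVf// expf_neq0.
have -> : S ((normR x)^-1%:C *: x) = (normR x)^-1%:C *: S x by exact: linearZ.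
rewrite innerZl innerZr mulrA e1.
have -> (r : R) (z : R[i]) : complex.Re (r%:C * z) = r * complex.Re z.
  by case: z => a b /=; rewrite mul0r subr0.
by rewrite normrM ger0_norm ?invr_ge0 ?sqr_ge0// mulrC ltr_pdivlMr ?exprn_gt0.
Qed.

End NumericalRadius.

(** * Bounds on the dilation constant *)

Section Compressions.
Context {R : realType} {H K : hilbertType R}.

Lemma isometry_normR (J : {linear H -> K}) : isometry inner inner J ->
  forall h, normR (J h) = normR h.
Proof.
move=> Ji h; apply/eqP; rewrite -(@eqrXn2 _ 2) ?normR_ge0//.
by apply/eqP/complexI; rewrite !normR_sq Ji.
Qed.

(** [P] is the adjoint of [J], given by the Riesz theorem applied to [h -> inner (J h) x]. *)
Lemma orthogonal_projection_ex (J : {linear H -> K}) : isometry inner inner J ->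
  exists P : K -> H, orthogonal_projection J P.
Proof.
move=> Ji.
have /choice[P hP] : forall x : K, exists y : H, forall h, inner (J h) x = inner h y.
  move=> x; apply: (@riesz _ _ (fun h => inner (J h) x) (normR x)) => [a y z|h].
    by rewrite linearP innerDl innerZl.
  rewrite (le_trans (inner_CauchySchwarz _ _))// !normRE -!rmorphM lecR.
  by rewrite isometry_normR// mulrC.
exists P => x h; rewrite innerDl innerNl Ji.
by rewrite [inner x _]innerC hP -innerC subrr.
Qed.

Lemma inner_projection (J : {linear H -> K}) (P : K -> H) :
  isometry inner inner J -> orthogonal_projection J P ->
  forall x h, inner (P x) h = inner x (J h).
Proof.
move=> Ji hP x h; rewrite -Ji; apply/esym/eqP.
by rewrite -subr_eq0 -innerNl -innerDl hP.
Qed.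

End Compressions.

(** * Index reversal and the cyclic symmetry of a constant form *)

Section ReversedTheta.
Context {R : realType} {d : nat} (theta : R) (Theta : 'M[R]_d).
Hypothesis antisym : Theta^T = - Theta.
Hypothesis const : forall k l : 'I_d, (k < l)%N -> Theta k l = theta.

Lemma ThetaC k l : Theta l k = - Theta k l.
Proof. by have := congr1 (fun M : 'M[R]_d => M k l) antisym; rewrite !mxE. Qed.

(** Reversal inverts the order of every pair, and all entries above the diagonal are equal. *)
Lemma Theta_rev k l : Theta (rev_ord k) (rev_ord l) = - Theta k l.
Proof.
have lt (a b : 'I_d) : (a < b)%N -> Theta (rev_ord a) (rev_ord b) = - theta.
  by move=> ab; rewrite ThetaC const//=; have := ltn_ord b; lia.
have [kl|lk|/val_inj kl] := ltngtP k l.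
- by rewrite lt// const.
- by rewrite ThetaC lt// ThetaC const.
- by rewrite kl; have := ThetaC l l; have := ThetaC (rev_ord l) (rev_ord l); lra.
Qed.

Definition signed_vec (b : bool) (x : {ffun 'I_d -> int}) := if b then - x else x.

Lemma bform_signed b c x y :
  bform Theta (signed_vec b x) (signed_vec c y) = (-1) ^+ (b (+) c) * bform Theta x y.
Proof.
by case: b; case: c; rewrite /= ?bformNl ?(bformNr antisym) ?opprK ?expr0 ?expr1 ?mul1r ?mulN1r.
Qed.

Hypothesis d_gt0 : (0 < d)%N.

Definition cyclic_shift (m j : 'I_d) : 'I_d := Ordinal (ltn_pmod (j + m) d_gt0).

(* [shift_vec (m, b)] is [(-1)^b] times the [m]-th iterate of the symmetry
   [e_0 -> e_1 -> ... -> e_(d-1) -> - e_0], which preserves [bform Theta]. *)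
Definition shift_vec (t : 'I_d * bool) (j : 'I_d) : {ffun 'I_d -> int} :=
  signed_vec (t.2 (+) (d <= j + t.1)%N) (lbasis (cyclic_shift t.1 j)).

(** The global sign [t.2] cancels. For [a < b], if just one index wraps around it is [b]: the order
    of the pair is then inverted and one minus sign appears, and the two effects compensate. *)
Lemma bform_shift_vec t k l : bform Theta (shift_vec t k) (shift_vec t l) = Theta k l.
Proof.
have lt (a b : 'I_d) : (a < b)%N -> bform Theta (shift_vec t a) (shift_vec t b) = Theta a b.
  move=> ab; rewrite bform_signed bform_basis (const ab).
  rewrite addbACA addbb addFb.
  have := ltn_ord b; have := ltn_ord t.1 => td bd.
  (* In order: both indices wrap; only [a] wraps, which contradicts [a < b]; only [b] wraps; neither
     wraps. *)
  have [ad|da] := leqP d (a + t.1); have [bd'|db] := leqP d (b + t.1).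
  - rewrite const ?mul1r//= -(subnK ad) -(subnK bd') !modnDr !modn_small; lia.
  - lia.
  - rewrite ThetaC const ?mulN1r ?opprK//= -(subnK bd') modnDr !modn_small; lia.
  - rewrite const ?mul1r//= !modn_small; lia.
have [kl|lk|/val_inj ->] := ltngtP k l; first exact: lt.
- by rewrite (bformC antisym) lt// [RHS]ThetaC.
- by rewrite (bformxx antisym); have := ThetaC l l; lra.
Qed.

(** For fixed [j], the [2 d] vectors [shift_vec t j] run through all signed basis vectors exactly
    once. *)
Lemma sum_shift_vec (V : zmodType) (g : {ffun 'I_d -> int} -> V) j :
  \sum_t g (shift_vec t j) = \sum_k (g (lbasis k) + g (- lbasis k)).
Proof.
rewrite (reindex_inj (h := cyclic_shift^~ j)) /=; last first.
  move=> m n /(congr1 val) /= /eqP; rewrite eqn_modDl !modn_small// => /eqP.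
  exact: val_inj.
rewrite -(pair_bigA _ (fun m b => g (shift_vec (m, b) j))) /=.
apply: eq_bigr => m _; rewrite big_bool /shift_vec /=.
by case: (d <= j + m)%N; rewrite //= addrC.
Qed.

End ReversedTheta.

Lemma inner_complex_line1 (R : realType) :
  inner (1 : complex_line R) (1 : complex_line R) = 1.
Proof. by change ((1 : R[i]) * Num.conj 1 = 1); rewrite rmorph1 mulr1. Qed.

Lemma square_summable_fin (R : realType) (T : finType) (K : hilbertType R) (f : T -> K) :
  f \in square_summable.
Proof.
apply/square_summableP; exists (\sum_t normR (f t) ^+ 2) => F.
rewrite /sqsum [leLHS]big_uniq ?fset_uniq//= big_mkcond; apply: ler_sum => t _.
by case: ifP => // _; exact: sqr_ge0.
Qed.

Lemma unitaryZ (R : realType) (A : cstarAlgType R) (a : R[i]) (x : A) : `|a| = 1 ->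
  unitary_elt x -> unitary_elt (a *: x).
Proof.
move=> a1 [x1 x2]; have aa : Num.conj a * a = 1 by rewrite mulrC -normCK a1 expr1n.
split; rewrite starZ scale_mull scale_mulr scalerA.
  by rewrite x1 aa scale1r.
by rewrite x2 mulrC aa scale1r.
Qed.

Definition real_sum (R : realType) (A : cstarAlgType R) d (u : 'I_d -> A) : A :=
  \sum_k (u k + star (u k)).

Section RealParts.
Context {R : realType} {A : cstarAlgType R} {d : nat}.
Implicit Types (u : 'I_d -> A).

Lemma star_real_sum u : star (real_sum u) = real_sum u.
Proof.
rewrite /real_sum (big_morph star (@starD _ _) (@star_zero _ _)).
by apply: eq_bigr => k _; rewrite starD starK addrC.
Qed.

Lemma smorph_real_sum (B : cstarAlgType R) (phi : A -> B) u :
  star_morphism_on setT phi -> phi (real_sum u) = real_sum (fun k => phi (u k)).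
Proof.
move=> phiP; rewrite /real_sum (smorph_sum phiP); apply: eq_bigr => k _.
by rewrite (smorphD phiP) (smorph_star phiP).
Qed.

End RealParts.

(** * The regular representation and the norms of the sums of generators *)

Section DilationConstant.
Context {R : realType} {d : nat} (d_gt0 : (0 < d)%N) (theta : R) (Theta : 'M[R]_d).
Hypothesis antisym : Theta^T = - Theta.
Hypothesis const : forall k l : 'I_d, (k < l)%N -> Theta k l = theta.
Context {A A0 : cstarAlgType R} (u : 'I_d -> A) (u0 : 'I_d -> A0).
Hypothesis u_univ : noncommutative_torus Theta u.
Hypothesis u0_univ : noncommutative_torus 0 u0.

Notation C := (complex_line R).
Notation Z := {ffun 'I_d -> int}.
Notation H := (ell2 Z C).
Let N := normR (real_sum u).

Let U (k : 'I_d) : 'B(H) := lam Theta (lbasis k) 1.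

Lemma regular_faithful : exists phi : A -> 'B(H), [/\ phi 1 = 1,
  star_morphism_on setT phi, forall k, phi (u k) = U k,
  forall a, normR (phi a) = normR a & tuple_equiv U u].
Proof.
apply: (@lam_faithful _ _ _ antisym _ _ _ _ (fun=> 1) (fun _ _ => 0) (1 : C) u_univ).
- by move=> k; exact: unitary1.
- by move=> k l; rewrite expi0 scale1r.
- by move=> k l; rewrite addr0.
- exact: inner_complex_line1.
Qed.

Lemma regular_unitary k : unitary_elt (U k).
Proof. by apply: lam_unitary => //; exact: unitary1. Qed.

Lemma regular_star k : star (U k) = lam Theta (- lbasis k) 1.
Proof. by rewrite lam_star ?star_one//; exact: unitary1. Qed.

Lemma normR_real_sum_regular : normR (real_sum U) = N.
Proof.
have [phi [_ phiP phiu phin _]] := regular_faithful.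
rewrite /N -phin (smorph_real_sum _ phiP).
by congr (normR (real_sum _)); apply/funext => k.
Qed.

Lemma ell2_sumE (I : choiceType) (K : hilbertType R) (J : Type) (s : seq J)
    (F : J -> ell2 I K) i : (\sum_(j <- s) F j) i = \sum_(j <- s) F j i.
Proof. exact: (big_morph (fun f : ell2 I K => f i)). Qed.

(** Applied to the basis vector at 0, the sum has a unimodular coordinate at [lbasis k0], to which
    only the term [U k0] contributes. *)
Lemma normR_real_sum_gt0 : 0 < N.
Proof.
rewrite -normR_real_sum_regular lt_neqAle normR_ge0 andbT eq_sym; apply/eqP => S0.
pose k0 : 'I_d := Ordinal d_gt0; pose f : H := ell2_single 0 (1 : C).
have fE s : f s = if s == 0 then 1 else 0 by [].
have : real_sum U f (lbasis k0) = 0 by rewrite (normR_eq0P S0).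
have UE k s : (U k + star (U k)) f s = expi (bform Theta s (lbasis k) / 2) *: f (s - lbasis k)
    + expi (bform Theta s (- lbasis k) / 2) *: f (s + lbasis k).
  by rewrite opD ell2DE regular_star !lamE !op1 opprK.
have add0 k : (lbasis k0 + lbasis k == 0 :> Z) = false.
  by apply/eqP => /ffunP/(_ k0); rewrite !ffunE eqxx; case: (k0 == k).
rewrite /real_sum op_sum ell2_sumE (eq_bigr _ (fun k _ => UE k _)) (bigD1 k0)// big1.
  rewrite !fE subrr eqxx add0 scaler0 -[X in X = _ -> _]/(_ + 0 + 0) !addr0 => /eqP.
  by rewrite scaler_eq0 oner_eq0 orbF -normr_eq0 norm_expi oner_eq0.
move=> k kk0; rewrite !fE add0.
have -> : (lbasis k0 - lbasis k == 0 :> Z) = false.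
  by apply/eqP => /ffunP/(_ k0); rewrite !ffunE eqxx eq_sym (negPf kk0).
by rewrite !scaler0 addr0.
Qed.

(** The character sending every generator to 1 takes the value [2 d] on the sum. *)
Lemma real_sum_commuting_ge : 2 * d%:R <= normR (real_sum u0).
Proof.
have rel : noncommutative_torus_relations 0 (fun _ : 'I_d => 1 : 'B(C)).
  by split=> [k|k l]; [exact: unitary1|rewrite mxE expi0 scale1r].
have [_ _ /(_ _ _ rel)[chi [chi1 chiP chiu]]] := u0_univ.
apply: le_trans (smorph_contractive chi1 chiP _).
rewrite (smorph_real_sum _ chiP).
have n1 : normR (1 : C) = 1.
  by apply/eqP; rewrite -(@eqrXn2 _ 2) ?normR_ge0// expr1n; apply/eqP/complexI;
    rewrite normR_sq inner_complex_line1.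
have := normR_op_le (real_sum (fun k => chi (u0 k))) (1 : C).
rewrite n1 mulr1; apply: le_trans.
have -> : real_sum (fun k => chi (u0 k)) (1 : C) = (2 * d%:R)%:C *: (1 : C).
  rewrite /real_sum op_sum (eq_bigr (fun=> 2%:R *: (1 : C))) => [|k _].
    rewrite sumr_const card_ord -scaler_nat scalerA -[X in _ = X *: _]/(real_complex R _).
    by rewrite rmorphM !rmorph_nat mulrC.
  by rewrite opD chiu star_one op1 scaler_nat.
by rewrite normR_scaleR n1 mulr1 ler_norm.
Qed.

(** * The lower bound for a given dilation *)

Section LowerBound.
Context {HH K : hilbertType R} (J : {linear HH -> K}) (Ji : isometry inner inner J).
Context (V : 'I_d -> 'B(K)) (W : 'I_d -> 'B(HH)) (c : R) (c_gt0 : 0 < c).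
Hypothesis W_rel : noncommutative_torus_relations Theta W.
Hypothesis V_rel : noncommutative_torus_relations 0 V.
Hypothesis WV : forall k h h', inner (W k h) h' = c%:C * inner (V k (J h)) (J h').

Let JZ : ell2 Z HH -> ell2 Z K := ell2_map (isometry_normR Ji).

Let lamWV k x f g :
  inner (lam Theta x (W k) f) g = c%:C * inner (lam Theta x (V k) (JZ f)) (JZ g).
Proof.
by apply: inner_ell2_scale => s; rewrite !lamE !innerZl WV /=; ring.
Qed.

Let lamWV_star k x f g :
  inner (lam Theta x (star (W k)) f) g
  = c%:C * inner (lam Theta x (star (V k)) (JZ f)) (JZ g).
Proof.
apply: inner_ell2_scale => s; rewrite !lamE !innerZl /= !op_starPr.
rewrite innerC WV rmorphM /= conj_realC -innerC; ring.
Qed.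

(** Reversing the indices negates the phases of [W], so the lattice factor cancels them and the
    [X k] commute; the [V k] commute already, so the [T k] take the phases of [Theta] from the
    lattice factor. *)
Let X k := lam Theta (lbasis k) (W (rev_ord k)).
Let T k := lam Theta (lbasis k) (V (rev_ord k)).

Lemma lower_bound_aux (h : HH) : inner h h = 1 -> 2 * d%:R <= c * N.
Proof.
move=> h1; have [Wu Wc] := W_rel; have [Vu Vc] := V_rel.
have XT f g : inner (real_sum X f) g = c%:C * inner (real_sum T (JZ f)) (JZ g).
  rewrite /real_sum !op_sum !inner_suml mulr_sumr; apply: eq_bigr => k _.
  rewrite !opD !innerDl mulrDr /X /T lamWV !lam_star//; congr (_ + _).
  exact: lamWV_star.
have TN : normR (real_sum T) <= N.
  have T_rel : noncommutative_torus_relations Theta T.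
    apply: (lam_relations antisym (t := fun _ _ => 0)) => // k l.
      by rewrite Vc mxE.
    by rewrite bform_basis addr0.
  have [_ _ /(_ _ _ T_rel)[phi [phi1 phiP phiu]]] := u_univ.
  apply: le_trans (smorph_contractive phi1 phiP _); rewrite (smorph_real_sum _ phiP).
  by have -> : (fun k => phi (u k)) = T by apply/funext.
have X_norm : normR (real_sum X) = normR (real_sum u0).
  have [phi [_ phiP phiu phin _]] := @lam_faithful _ _ _ antisym _ _ _ _
    (fun k => W (rev_ord k)) (fun k l => - Theta k l) h u0_univ
    (fun k => Wu _) (fun k l => ltac:(by rewrite Wc (Theta_rev antisym const)))
    (fun k l => ltac:(by rewrite subrr mxE)) h1.
  rewrite -phin (smorph_real_sum _ phiP).
  by congr (normR (real_sum _)); apply/funext => k.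
apply: (le_trans real_sum_commuting_ge); rewrite -X_norm.
apply: op_norm_le => [|f]; first by rewrite mulr_ge0 ?normR_ge0 ?ltW.
(* Testing [real_sum X f] against itself and moving through [XT] replaces [X] by [c T], whose sum
   has norm at most [N]. *)
apply: normR_inner_le; first by rewrite !mulr_ge0 ?normR_ge0 ?ltW.
rewrite -lecR normR_sq; apply: (le_trans (real_ler_norm _)).
  by rewrite -normR_sq complex_real.
rewrite XT normrM -mulrA.
have -> : `|c%:C : R[i]| = c%:C by rewrite ger0_norm// lecR ltW.
rewrite -!mulrA [leRHS]rmorphM; apply: ler_wpM2l; first by rewrite lecR ltW.
apply: (le_trans (inner_CauchySchwarz _ _)); rewrite !normRE -!rmorphM lecR.
rewrite !normR_ell2_map mulrA ler_wpM2r ?normR_ge0// (le_trans (normR_op_le _ _))//.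
by rewrite normR_ell2_map ler_wpM2r ?normR_ge0.
Qed.

End LowerBound.

Lemma lower_bound (c : R) : 0 < c -> dilates u c u0 -> 2 * d%:R <= c * N.
Proof.
move=> c0 [HH [K [J [P [W [V [Ji hP Wu Vu0 WV]]]]]]].
have [ur ug _] := u_univ; have [u0r u0g _] := u0_univ.
have Wr := tuple_equiv_relations ug Wu ur.
have Vr := tuple_equiv_relations u0g Vu0 u0r.
(* If [HH] were zero, its only operator would be 0, and surjectivity of [psi] would make [A]
   trivial, contradicting [N > 0]. *)
have [h h1] : exists h : HH, inner h h = 1.
  apply: contrapT => noh.
  have H0 (h : HH) : h = 0.
    apply/eqP; apply: contraT => h0; exfalso; apply: noh.
    have n0 : normR h != 0 by rewrite normR_eq0.
    exists ((normR h)^-1%:C *: h).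
    by rewrite innerZl innerZr -normR_sq conj_realC -!rmorphM expr2 mulKf// mulVf.
  have B0 (S S' : 'B(HH)) : S = S' by apply: bounded_opE => x; rewrite (H0 (S x)) (H0 (S' x)).
  have [psi [[_ _ psis] _ _]] := Wu.
  have A0' (a b : A) : a = b.
    have [|x _ <-] := psis a; first by rewrite ug.
    have [|y _ <-] := psis b; first by rewrite ug.
    by rewrite (B0 x y).
  by have := normR_real_sum_gt0; rewrite /N (A0' (real_sum u) 0) normR_zero ltxx.
apply: (lower_bound_aux Ji c0 Wr Vr _ h1) => k h2 h'.
by rewrite WV (inner_projection Ji hP) innerZl.
Qed.

Lemma ell2_singleE (I : choiceType) (K : hilbertType R) (i : I) (h : K) :
  ell2_single i h i = h.
Proof. by rewrite /= eqxx. Qed.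

Lemma lam_tensor (K : hilbertType R) x (X : 'B(K)) (xi : H) (h : K) :
  lam Theta x X (tensor xi h) = tensor (lam Theta x 1 xi) (X h).
Proof.
apply: ell2E => s; have XZ (a : R[i]) : X (a *: h) = a *: X h by exact: linearZ.
change (expi (bform Theta s x / 2) *: X ((xi (s - x) : R[i]) *: h)
  = (expi (bform Theta s x / 2) * (xi (s - x) : R[i])) *: X h).
by rewrite XZ scalerA.
Qed.

(** * The upper bound: a commuting dilation built from a vector state *)

Section UpperBound.
Context (sigma : R) (sigma1 : `|sigma| = 1) (xi : H) (xi1 : inner xi xi = 1).

Let T : finType := ('I_d * bool)%type.
Let vec (t : T) (k : 'I_d) : Z := shift_vec d_gt0 t (rev_ord k).
Let sU (k : 'I_d) : 'B(H) := sigma%:C *: U k.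
(** The direct sum over the [2 d] symmetries turns the averaged state into a vector state, that of
    [eta] tensor [xi]. The sign [sigma] in [sU] will make its value positive and leaves the
    commutation phases unchanged. *)
Let V (k : 'I_d) : 'B(ell2 T (ell2 Z H)) := diag_op (fun t => lam Theta (vec t k) (sU k)).

Let sU_unitary k : unitary_elt (sU k).
Proof.
apply: unitaryZ; last exact: regular_unitary.
by rewrite -[LHS](@RRe_real R) ?normr_real// Re_norm_real sigma1.
Qed.

Let lam_vec_unitary k t : unitary_elt (lam Theta (vec t k) (sU k)).
Proof. exact: lam_unitary. Qed.

Let U_comm k l : U l * U k = expi (Theta k l) *: (U k * U l).
Proof.
rewrite -(bform_basis Theta k l) -[expi _]mulr1; apply: lam_comm => //.
by rewrite scale1r.
Qed.

(** Reversal in [vec] gives the lattice factor the phase [- Theta k l], for every [t], which cancels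
    that of [U]. *)
Let V_rel : noncommutative_torus_relations 0 V.
Proof.
split=> [k|k l]; first exact: diag_unitary.
apply: diag_comm => t.
have -> : expi ((0 : 'M[R]_d) k l) = expi (bform Theta (vec t k) (vec t l)) * expi (Theta k l).
  by rewrite -expiD (bform_shift_vec antisym const) (Theta_rev antisym const) addNr mxE.
apply: lam_comm => //.
by rewrite !scale_mull !scale_mulr !scalerA U_comm !scalerA mulrC.
Qed.

(** The degree is read off the factor on which [sU k] acts, since there the shift is by [lbasis k]
    for all [t], whereas the shift [vec t k] in the other lattice factor varies with [t]. *)
Let E (n : Z) : set (ell2 T (ell2 Z H)) :=
  [set f : ell2 T (ell2 Z H) | forall t s, homogeneous n (f t s)].

Let E_shift (X : T -> Z) (Y : 'B(H)) n m f :
  (forall g : H, homogeneous n g -> homogeneous m (Y g)) ->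
  E n f -> E m (diag_op (fun t => lam Theta (X t) Y) f).
Proof.
move=> YE Ef t s r rm; rewrite diagE lamE ell2ZE YE ?scaler0//.
Qed.

Lemma twisted_tuple_equiv : tuple_equiv V u0.
Proof.
pose t0 : T := (Ordinal d_gt0, true).
pose e : ell2 T (ell2 Z H) := ell2_single t0 (ell2_single 0 (ell2_single 0 (1 : C))).
have Eg k n f : E n f -> E (n + lbasis k) (V k f).
  apply: E_shift => g hg r rn; rewrite opZ ell2ZE.
  by rewrite (@lam_homogeneous _ _ Theta _ _ _ _ _ hg _ rn) scaler0.
have Es k n f : E n f -> E (n - lbasis k) (star (V k) f).
  rewrite /V diag_star//.
  have -> : (fun t => star (lam Theta (vec t k) (sU k)))
      = (fun t => lam Theta (- vec t k) (star (sU k))).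
    by apply/funext => t; rewrite lam_star.
  apply: E_shift => g hg r rn; rewrite starZ opZ ell2ZE regular_star.
  by rewrite (@lam_homogeneous _ _ Theta _ _ _ _ _ hg _ rn) scaler0.
have Eo n f g : n != 0 -> E n f -> E 0 g -> inner f g = 0.
  move=> n0 Ef Eg0; apply: inner_ell2_eq0 => t; apply: inner_ell2_eq0 => s.
  exact: homogeneous_orth n0 (Ef t s) (Eg0 t s).
have Ee : E 0 e.
  move=> t s r r0; rewrite /=; case: (t == t0) => //=; case: (s == 0) => //=.
  by rewrite (negPf r0).
have e1 : inner e e = 1.
  by rewrite !(inner_single, ell2_singleE) inner_complex_line1.
by have [phi [_ _ _ _ hV]] := graded_faithful u0_univ V_rel Eg Es Eo Ee e1.
Qed.

Let kappa : R := (Num.sqrt (2 * d%:R))^-1.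

Let kappa2 : kappa ^+ 2 = (2 * d%:R)^-1.
Proof. by rewrite exprVn sqr_sqrtr. Qed.

(** The constant unit vector on the [2 d] points of [T]; it gives all symmetries equal weight. *)
Let eta : ell2 T C := Ell2 (square_summable_fin (fun _ : T => kappa%:C : C)).

Let d_neq0 : (d%:R : R) != 0. Proof. by rewrite pnatr_eq0 -lt0n. Qed.

Let inner_eta : inner eta eta = 1.
Proof.
rewrite inner_ell2_fin (eq_bigr (fun=> ((2 * d%:R)^-1)%:C)) => [|t _].
  transitivity ((\sum_(t : T) (2 * d%:R)^-1)%:C : R[i]); first by rewrite rmorph_sum.
  rewrite sumr_const card_prod card_ord card_bool -(mulr_natr _ (d * 2)) natrM.
  by rewrite mulrC [d%:R * _]mulrC divff// mulf_neq0.
change (kappa%:C * Num.conj kappa%:C = ((2 * d%:R)^-1)%:C :> R[i]).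
by rewrite conj_realC -rmorphM -expr2 kappa2.
Qed.

Let Jfun (h : H) : ell2 T (ell2 Z H) := tensor eta (tensor xi h).

Let J_linear : linear Jfun.
Proof.
move=> a x y; apply: ell2E => t; apply: ell2E => s.
change (kappa%:C *: ((xi s : R[i]) *: (a *: x + y)) =
  a *: (kappa%:C *: ((xi s : R[i]) *: x)) + kappa%:C *: ((xi s : R[i]) *: y)).
rewrite !scalerDr !scalerA; congr (_ *: _ + _); ring.
Qed.

Let J : {linear H -> ell2 T (ell2 Z H)} :=
  HB.pack Jfun (GRing.isLinear.Build R[i] H (ell2 T (ell2 Z H)) _ Jfun J_linear).

Let J_iso : isometry inner inner J.
Proof.
move=> x y; change (inner (Jfun x) (Jfun y) = inner x y).
by rewrite !inner_tensor inner_eta xi1 !mul1r.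
Qed.

Let rho : R := complex.Re (inner (real_sum U xi) xi).

Let rhoE : inner (real_sum U xi) xi = rho%:C.
Proof.
rewrite /rho RRe_real// CrealE; apply/eqP.
by rewrite -innerC [RHS]op_starP star_real_sum.
Qed.

(** Summing over [t] runs through all signed basis vectors, so the state contributes [rho] for every
    [k]; the weight [kappa ^+ 2] supplies the denominator [2 d]. *)
Let inner_VJ k h h' :
  inner (V k (J h)) (J h') = ((sigma * rho) / (2 * d%:R))%:C * inner (U k h) h'.
Proof.
have sv : \sum_(t : T) inner (lam Theta (vec t k) 1 xi) xi = rho%:C.
  rewrite -rhoE /real_sum op_sum inner_suml.
  under [RHS]eq_bigr do rewrite opD innerDl regular_star.
  exact: (sum_shift_vec d_gt0 (fun x => inner (lam Theta x 1 xi) xi)).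
rewrite inner_ell2_fin (eq_bigr (fun t => (kappa ^+ 2 * sigma)%:C *
   (inner (U k h) h' * inner (lam Theta (vec t k) 1 xi) xi))) => [|t _].
  rewrite -mulr_sumr -mulr_sumr sv kappa2.
  by rewrite mulrCA mulrC -rmorphM; congr (_%:C * _); field.
have LZ (S : 'B(ell2 Z H)) f : S (kappa%:C *: f) = kappa%:C *: S f by exact: linearZ.
change (inner (lam Theta (vec t k) (sU k) (kappa%:C *: tensor xi h)) (kappa%:C *: tensor xi h')
  = (kappa ^+ 2 * sigma)%:C * (inner (U k h) h' * inner (lam Theta (vec t k) 1 xi) xi)).
rewrite LZ lam_tensor innerZl innerZr inner_tensor opZ innerZl conj_realC expr2 !rmorphM /=.
ring.
Qed.

Lemma upper_bound_aux : 0 < sigma * rho -> dilates u (2 * d%:R / (sigma * rho)) u0.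
Proof.
move=> sr0; have [P hP] := orthogonal_projection_ex J_iso.
exists H, (ell2 T (ell2 Z H)), J, P, U, V; split => //.
- by have [phi [_ _ _ _ hU]] := regular_faithful.
- exact: twisted_tuple_equiv.
- move=> k h; apply: innerI => h'.
  have -> : inner h' (P ((2 * d%:R / (sigma * rho))%:C *: V k (J h)))
      = Num.conj (inner ((2 * d%:R / (sigma * rho))%:C *: V k (J h)) (J h')).
    by rewrite -(inner_projection J_iso hP); exact: innerC.
  rewrite innerZl inner_VJ mulrA -rmorphM.
  have -> : 2 * d%:R / (sigma * rho) * (sigma * rho / (2 * d%:R)) = 1.
    by rewrite mulrA divfK ?gt_eqF// divff// mulf_neq0.
  rewrite mul1r; exact: innerC.
Qed.

End UpperBound.

Lemma upper_bound (M : R) : 0 <= M -> M < N ->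
  exists r : R, M < r /\ dilates u (2 * d%:R / r) u0.
Proof.
move=> M0 MN; have [xi [xi1 Mxi]] : exists x : H, inner x x = 1 /\
    M < `|complex.Re (inner (real_sum U x) x)|.
  by apply: numerical_radius_ex => //; [exact: star_real_sum|rewrite normR_real_sum_regular].
set rho := complex.Re _ in Mxi.
exists `|rho|; split => //.
(* The quadratic form may be close to [- N] instead of [N]; [sigma] is the sign of its value. *)
pose sigma : R := if 0 <= rho then 1 else -1.
have sr : sigma * rho = `|rho|.
  rewrite /sigma; case: (lerP 0 rho) => h; first by rewrite mul1r ger0_norm.
  by rewrite mulN1r ltr0_norm.
have s1 : `|sigma| = 1 by rewrite /sigma; case: ifP; rewrite ?normrN normr1.
rewrite -sr; apply: (upper_bound_aux s1 xi1); rewrite sr.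
exact: le_lt_trans M0 Mxi.
Qed.

End DilationConstant.

(** * From the two bounds to the infimum *)

Theorem proposition4p6 (R : realType) (d : nat) (d_gt0 : (0 < d)%N)
    (theta : R) (Theta : 'M[R]_d)
    (Theta_antisym : Theta^T = - Theta)
    (Theta_const : forall k l : 'I_d, (k < l)%N -> Theta k l = theta)
    (A A0 : cstarAlgType R) (u : 'I_d -> A) (u0 : 'I_d -> A0)
    (u_univ : noncommutative_torus Theta u)
    (u0_univ : noncommutative_torus 0 u0) :
  dilation_constant u u0
  = ((2 * d%:R) / normR (\sum_(k < d) (u k + star (u k))))%:E.
Proof.
have N0 := normR_real_sum_gt0 d_gt0 Theta_antisym u_univ.
rewrite -/(real_sum u); set N := normR (real_sum u) in N0 *.
have d0 : 0 < 2 * d%:R :> R by rewrite mulr_gt0// ltr0n.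
apply/eqP; rewrite eq_le; apply/andP; split; last first.
  apply: le_ereal_inf_tmp => _ [c [c0 hc] <-]; rewrite lee_fin ler_pdivrMr//.
  exact: (lower_bound d_gt0 Theta_antisym Theta_const u_univ u0_univ).
apply/lee_addgt0Pr => e e0; rewrite -EFinD.
(* Since [2 d / q < N], the upper bound provides some [r > 2 d / q], so the dilation factor
   [2 d / r] lies below [q]. *)
pose q := 2 * d%:R / N + e.
have q0 : 0 < q by rewrite addr_gt0// divr_gt0.
have MN : 2 * d%:R / q < N.
  by rewrite ltr_pdivrMr// /q mulrDr [N * (_ / N)]mulrC divfK ?gt_eqF// ltrDl mulr_gt0.
have M0 : 0 < 2 * d%:R / q by rewrite divr_gt0.
have [r [Mr hr]] := upper_bound d_gt0 Theta_antisym Theta_const u_univ u0_univ (ltW M0) MN.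
have r0 : 0 < r := lt_trans M0 Mr.
apply: le_trans (_ : ((2 * d%:R / r)%:E <= _)%E).
  by apply: ereal_inf_lbound; exists (2 * d%:R / r) => //; split => //; exact: divr_gt0.
by rewrite lee_fin -/q ler_pdivrMr// [q * r]mulrC -ler_pdivrMr// ltW.
Qed.
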